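(* Let $X\in\mathbb R^{n\times p}$, $\varrho\ge\|X\|_2$ with $\varrho>0$, $l(\beta)=l_0(X\beta)$ directionally differentiable, $\Theta$ a thresholding function with associated penalty $P_\Theta$ and number $\mathcal L_\Theta$, and $\psi:\mathbb R^p\to\mathbb R$ any directionally differentiable function. Let $\beta^*\in\mathbb R^p$ be such that $l_0$ is differentiable at $X\beta^*$ and the effective noise $\epsilon=-\nabla l_0(X\beta^* )$ is sub-Gaussian with mean zero and scale bounded by $\sigma$. Suppose that for some pseudo-metric $d$ and some $-\infty\le\alpha\le L\le+\infty$, $$\alpha\, d^2(\eta,\eta')\le\mathbf\Delta_{l_0}(\eta,\eta')\le L\,d^2(\eta,\eta')\quad\text{for all }\eta,\eta'.$$ Assume that for a given $\beta\in\mathbb R^p$ there exist $r$ with $0\le r<1$ and $\alpha r/L\ge0$, positive $\delta,\vartheta$, and a large enough $K\ge0$ such that for any $\gamma\in\mathbb R^p$ $$\varrho^2\mathcal L_\Theta\mathbf D_2(\beta,\gamma)+\delta\mathbf D_2(X\beta,X\gamma)+\vartheta P_H(\varrho(\beta-\gamma);\lambda)+P_\Theta(\varrho\beta;\lambda)\le\Big(1+\frac{\alpha}{L}r\Big)\mathbf\Delta_l(\beta,\gamma)+P_\Theta(\varrho\gamma;\lambda)+K\lambda^2J(\beta),$$ where $\lambda=A\sigma\sqrt{\log(ep)}/\sqrt{(\delta\wedge\vartheta)\vartheta}$ with $A$ a sufficiently large constant. Let $\hat\beta$ be any fixed point of the surrogate, i.e. $\hat\beta\in\arg\min_{\beta'}g(\beta';\hat\beta)$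 with $g(\beta';\beta^-)=l(\beta')+P_\Theta(\varrho\beta';\lambda)+\mathbf\Delta_\psi(\beta',\beta^-)$. Then the following oracle inequality holds for some constant $C>0$: $$\mathbb E\,\mathbf\Delta_l(\hat\beta,\beta^* )\le\mathbb E\Big\{\Big(\frac{1+r}{1-r}\Big)^2\mathbf\Delta_l(\beta,\beta^* )+\frac{(1+r)KA^2}{(1-r)(2\vartheta\wedge\delta)\vartheta}\sigma^2J(\beta)\log(ep)\Big\}+\frac{C(1+r)}{(1-r)(2\vartheta\wedge\delta)}\sigma^2 .$$
   Context: Directional derivative: $\delta\psi(\beta;h)=\lim_{\epsilon\to0+}[\psi(\beta+\epsilon h)-\psi(\beta)]/\epsilon$; $\psi$ is directionally differentiable if this exists and is finite for all $\beta,h$. Generalized Bregman function: $\mathbf\Delta_\psi(\beta,\gamma)=\psi(\beta)-\psi(\gamma)-\delta\psi(\gamma;\beta-\gamma)$; $\mathbf D_2(a,b)=\|a-b\|_2^2/2$. A pseudo-metric $d$ is a nonnegative, symmetric function satisfying the triangle inequality $d(\eta_1,\eta_2)\le d(\eta_1,\eta_3)+d(\eta_2,\eta_3)$. A thresholding function $\Theta(t;\lambda)$ is a real-valued function defined for $t\in\mathbb R$, $0\le\lambda<\infty$ with (i) $\Theta(-t;\lambda)=-\Theta(t;\lambda)$; (ii) $\Theta(t;\lambda)\le\Theta(t';\lambda)$ for $t\le t'$; (iii) $\lim_{t\to\infty}\Theta(t;\lambda)=\infty$; (iv) $0\le\Theta(t;\lambda)\le t$ for $0\le t<\infty$. Put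 $\Theta^{-1}(u;\lambda)=\sup\{t:\Theta(t;\lambda)\le u\}$ for $u>0$, $P_\Theta(t;\lambda)=\int_0^{|t|}(\Theta^{-1}(u;\lambda)-u)\,du$, and $\mathcal L_\Theta=1-\mathrm{ess\,inf}\{d\Theta^{-1}(u;\lambda)/du:u\ge0\}$. The hard penalty is $P_H(t;\lambda)=(-t^2/2+\lambda|t|)1_{|t|<\lambda}+(\lambda^2/2)1_{|t|\ge\lambda}$. For vectors, $P(\beta;\lambda)=\sum_jP(\beta_j;\lambda)$. $J(\beta)=\|\beta\|_0$. $a\wedge b=\min(a,b)$; $2\vartheta\wedge\delta=\min(2\vartheta,\delta)$; $\|X\|_2$ is the spectral norm. The loss $l_0$ depends on random data, so $\epsilon$ is random; its components need not be independent. The scale of a random variable $\xi$ is $\|\xi\|_{\psi_2}=\inf\{s>0:\mathbb E\exp(\xi^2/s^2)\le2\}$; a random vector $\xi$ is sub-Gaussian with scale bounded by $\sigma$ if $\|\langle\xi,a\rangle\|_{\psi_2}\le\sigma\|a\|_2$ for all $a$. When $r=0$ the quantity $\frac{\alpha}{L}r$ is read as $0$.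
   Formalization: The inequality is shown with α≥0 required whenever r>0, and with C absolute only if δ≤ϑ (for δ>ϑ, C may depend on A, p, K, δ, ϑ); concave losses with α=L<0, and noiseless soft thresholding with δ=2ϑ→0, violate the unrestricted claim. *)

(* Defs.v *)
(* MathComp / MathComp-Analysis. *)
From HB Require Import structures.
From mathcomp Require Import all_boot all_order all_algebra.
From mathcomp Require Import all_classical all_reals all_analysis.
From mathcomp Require Import ess_sup_inf.

Set Implicit Arguments.
Unset Strict Implicit.
Unset Printing Implicit Defensive.

Import Order.TTheory GRing.Theory Num.Theory.
Import numFieldNormedType.Exports.

Local Open Scope classical_set_scope.
Local Open Scope ring_scope.

Section Vectors.
Context {R : realType}.

Definition dotv k (u v : 'cV[R]_k) : R := \sum_(i < k) u i 0 * v i 0.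

(* The library norm `|u| on matrices is the sup norm. *)
Definition l2norm k (u : 'cV[R]_k) : R := Num.sqrt (dotv u u).

Definition l0norm k (u : 'cV[R]_k) : nat := #|[set i : 'I_k | u i 0 != 0]%SET|.

Definition D2 k (u v : 'cV[R]_k) : R := l2norm (u - v) ^+ 2 / 2.

Definition spectral_norm n p (X : 'M[R]_(n, p)) : R :=
  sup [set l2norm (X *m u) | u in [set u : 'cV[R]_p | l2norm u <= 1]].

Definition pseudo_metric (E : Type) (d : E -> E -> R) : Prop :=
  [/\ forall x y, 0 <= d x y,
      forall x y, d x y = d y x
    & forall x y z, d x y <= d x z + d y z].

End Vectors.

Section Bregman.
Context {R : realType} {k : nat}.
Implicit Types (psi : 'cV[R]_k -> R) (b h : 'cV[R]_k).

Definition dquot psi b h (e : R) : R := (psi (b + e *: h) - psi b) / e.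

Definition ddir psi b h : R := lim (dquot psi b h @ 0^'+).

Definition dir_differentiable psi : Prop :=
  forall b h, cvg (dquot psi b h @ 0^'+).

Definition Bregman psi b c : R := psi b - psi c - ddir psi c (b - c).

Definition grad psi b : 'cV[R]_k := \col_i 'D_(delta_mx i 0) psi b.

End Bregman.

Section Thresholding.
Context {R : realType}.
Implicit Types (Theta : R -> R -> R) (lambda t u : R).

(* Theta t lambda is the thresholding of t at level lambda. *)
Definition thresholding Theta : Prop :=
  forall lambda, 0 <= lambda ->
  [/\ forall t, Theta (- t) lambda = - Theta t lambda,
      forall t t', t <= t' -> Theta t lambda <= Theta t' lambda,
      Theta t lambda @[t --> +oo] --> +oo
    & forall t, 0 <= t -> 0 <= Theta t lambda <= t].

Definition Theta_inv Theta lambda u : R := sup [set t | Theta t lambda <= u].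

Definition P_Theta Theta lambda t : R :=
  \int[@lebesgue_measure R]_(u in `]0, `|t|]%classic) (Theta_inv Theta lambda u - u).

(* The value +oo off [0, +oo[ restricts the essential infimum to u >= 0.  For a
   thresholding function, Theta_inv is finite and nondecreasing on u > 0, hence
   differentiable almost everywhere there, and the essential infimum is a
   nonnegative real number, so that fine loses nothing. *)
Definition L_Theta Theta lambda : R :=
  1 - fine (ess_inf (@lebesgue_measure R)
    (fun u : R => if 0 <= u then (derive1 (Theta_inv Theta lambda) u)%:E else +oo%E)).

Definition P_H lambda t : R :=
  if `|t| < lambda then - t ^+ 2 / 2 + lambda * `|t| else lambda ^+ 2 / 2.

Definition sum_pen (pen : R -> R) k (b : 'cV[R]_k) : R := \sum_(j < k) pen (b j 0).

End Thresholding.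

Section SubGaussian.
Context {R : realType} {d : measure_display} {T : measurableType d}
  (P : probability T R).

Definition psi2_norm (xi : T -> R) : \bar R :=
  ereal_inf [set s%:E | s in [set s : R | 0 < s /\
    ('E_P[fun w => expR (xi w ^+ 2 / s ^+ 2)%R] <= 2%:E)%E]].

Definition subgaussian_vec k (xi : T -> 'cV[R]_k) (sigma : R) : Prop :=
  (forall i, measurable_fun setT (fun w => xi w i 0)) /\
  forall a : 'cV[R]_k,
    (psi2_norm (fun w => dotv (xi w) a) <= (sigma * l2norm a)%:E)%E.

Definition mean_zero_vec k (xi : T -> 'cV[R]_k) : Prop :=
  forall i, ('E_P[fun w => xi w i 0%R] = 0)%E.

End SubGaussian.

Section Surrogate.
Context {R : realType} {p : nat}.

Definition surrogate (l psi : 'cV[R]_p -> R) (Theta : R -> R -> R)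
    (rho lambda : R) (b bminus : 'cV[R]_p) : R :=
  l b + sum_pen (P_Theta Theta lambda) (rho *: b) + Bregman psi b bminus.

Definition fixed_point (l psi : 'cV[R]_p -> R) (Theta : R -> R -> R)
    (rho lambda : R) (bhat : 'cV[R]_p) : Prop :=
  forall b, surrogate l psi Theta rho lambda bhat bhat
            <= surrogate l psi Theta rho lambda b bhat.

End Surrogate.

Definition log_ep {R : realType} (p : nat) : R := ln (expR 1 * p%:R).

Definition lambda_level {R : realType} (A sigma delta vartheta : R) (p : nat) : R :=
  A * sigma * Num.sqrt (log_ep p) / Num.sqrt (Num.min delta vartheta * vartheta).

(* Main.v *)
Require Import Defs.
From HB Require Import structures.
From mathcomp Require Import all_boot all_order all_algebra.
From mathcomp Require Import all_classical all_reals all_analysis.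
From mathcomp Require Import ess_sup_inf.
From mathcomp Require Import measurable_realfun.
From mathcomp Require Import ring lra zify.

Set Implicit Arguments.
Unset Strict Implicit.
Unset Printing Implicit Defensive.

Import Order.TTheory GRing.Theory Num.Theory.
Import numFieldNormedType.Exports.

Local Open Scope classical_set_scope.
Local Open Scope ring_scope.

(* Write L for L_Theta and g for betahat - beta.  P_Theta + L t^2 / 2 is convex,
   because u |-> Theta_inv u - (1 - L) u is nondecreasing; hence first-order
   optimality of betahat in the surrogate gives
     l betahat + P_Theta betahat + Delta_l(beta, betahat)
       <= l beta + P_Theta beta + rho^2 L D2(beta, betahat).
   Linearizing l0 at X betastar and inserting the regularity condition leaves
   (alpha r / L) Delta_l(beta, betahat), which the triangle inequality for the
   pseudo-metric absorbs, and the noise term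
     <eps, X g> - (delta / 2) |X g|^2 - vartheta P_H(rho g).
   The latter is convex in each coordinate of g below the threshold, so it is
   largest at a hard-thresholded vector; if S is the support of that vector, the
   noise term is at most
     (|Pi_S eps|^2 - A^2 sigma^2 |S| log(ep)) / (2 delta),
   Pi_S being the projection onto the span of the columns of X in S.  A lattice
   net bounds E exp(|Pi_S eps|^2 / (40 sigma^2)) by 2 B^|S| with B absolute, and
   summing the resulting exponential bounds over all S gives a constant as soon
   as A^2 >= 40 (1 + ln B). *)

(** * Monotone functions and the penalty *)

(** Gives the slope 1 of the measure of [U] cut at a moving endpoint, wherever the endpoint moves
    inside [U]. *)
Lemma lebesgue_measure_setI_itv_add (R : realType) (U : set R) (a x y : R) :
    open U -> a <= x -> x <= y -> (lebesgue_measure U < +oo)%E ->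
    `]x, y] `<=` U ->
  fine (lebesgue_measure (U `&` `]a, y]))
    = fine (lebesgue_measure (U `&` `]a, x])) + (y - x).
Proof.
move=> oU ax xy Ufin xyU.
have mU : measurable U by exact: open_measurable.
have -> : U `&` `]a, y] = (U `&` `]a, x]) `|` `]x, y].
  apply/seteqP; split=> [t [Ut] /=|t /=]; rewrite !in_itv /=.
    move=> /andP[at_ ty]; have [tx|xt] := leP t x; last by right.
    by left; rewrite at_.
  move=> [[Ut /andP[at_ tx]]|/andP[xt ty]].
    by split=> //; rewrite at_ (le_trans tx xy).
  split; first by apply: xyU => /=; rewrite in_itv/= xt.
  by rewrite (le_lt_trans ax xt).
rewrite measureU//=; last 2 first.
- by apply: measurableI.
- apply/seteqP; split=> t //= [[_]]; rewrite !in_itv/= => /andP[_ tx] /andP[xt _].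
  by move: (lt_le_trans xt tx); rewrite ltxx.
have f1 : lebesgue_measure (U `&` `]a, x]) \is a fin_num.
  rewrite ge0_fin_numE//; apply: le_lt_trans Ufin.
  by apply: le_measure; rewrite ?inE//; exact: measurableI.
rewrite fineD// lebesgue_measure_itv/= lte_fin; last by case: ifP.
move: xy; rewrite le_eqVlt => /predU1P[->|->//].
by rewrite ltxx subrr.
Qed.

(* Add to f the function c |U `&` ]a, x]|, U being an open set of small measure
   that contains the exceptional null set: the sum grows at rate c at every
   point, so that no almost-everywhere differentiability theorem is needed. *)
Lemma nondecreasing_ae_derive1_ge (R : realType) (f : R -> R) (c a b : R) :
    0 <= c -> a <= b -> {in `[a, b] &, {homo f : x y / x <= y}} ->
    {ae (@lebesgue_measure R), forall x, a <= x < b -> c <= derive1 f x} ->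
  c * (b - a) <= f b - f a.
Proof.
rewrite le_eqVlt => /predU1P[<- ab f_nd _|c0 ab f_nd [N [mN N0 fN]]].
  by rewrite mul0r subr_ge0 f_nd// in_itv/= lexx ab.
(* A loss [c - c'] in the slope and an extra mass [e] are allowed first. Choosing them so that each
   costs at most half of the tolerance removes both. *)
suff key c' e : 0 < c' < c -> 0 < e -> c' * (b - a) <= f b - f a + c * e.
  apply/ler_addgt0Pr => e e0.
  have d0 : 0 < Num.min (c / 2) (e / (2 * (b - a + 1))).
    by rewrite lt_min !divr_gt0 ?mulr_gt0// ltr_wpDl// subr_ge0.
  set d := Num.min _ _ in d0.
  have dc : d <= c / 2 by rewrite ge_min lexx.
  have de : d * (2 * (b - a + 1)) <= e.
    by rewrite -ler_pdivlMr ?ge_min ?lexx ?orbT// mulr_gt0// ltr_wpDl ?subr_ge0.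
  have := key (c - d) (e / (2 * c)).
  have -> : c * (e / (2 * c)) = e / 2.
    by field; rewrite gt_eqF.
  have -> : (0 < c - d < c) by apply/andP; split; lra.
  rewrite divr_gt0 ?mulr_gt0// => /(_ isT isT).
  nra.
move=> /andP[c'0 c'c] e0.
have [U [oU NU UN]] : exists U : set R,
    [/\ open U, N `<=` U & (lebesgue_measure U < e%:E)%E].
  have [|U [oU NU UN]] := @lebesgue_regularity_outer R N e mN _ e0.
    by rewrite [X in (X < _)%E]N0.
  exists U; split => //; apply: le_lt_trans UN.
  rewrite -[X in lebesgue_measure X](setDUK NU) measureU//=.
  - by rewrite [X in (X + _)%E]N0 add0e.
  - by apply: measurableD => //; exact: open_measurable.
  - by rewrite setIDA setDE setIAC setICr set0I.
have Ufin : (lebesgue_measure U < +oo)%E by rewrite (lt_trans UN)// ltry.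
have mU : measurable U by exact: open_measurable.
pose h x := fine (lebesgue_measure (U `&` `]a, x])).
have hfin x : lebesgue_measure (U `&` `]a, x]) \is a fin_num.
  rewrite ge0_fin_numE//; apply: le_lt_trans Ufin.
  by apply: le_measure; rewrite ?inE//; exact: measurableI.
have h_nd x y : x <= y -> h x <= h y.
  move=> xy; rewrite fine_le// le_measure ?inE//; try exact: measurableI.
  apply: setIS => t /=; rewrite !in_itv/= => /andP[-> /=].
  by move=> /le_trans; apply.
have h_ge0 x : 0 <= h x by apply: fine_ge0.
have h_le x : h x <= e.
  rewrite -lee_fin fineK//; apply: le_trans (ltW UN).
  by apply: le_measure; rewrite ?inE//; exact: measurableI.
pose F x := f x - f a + c * h x.
have F_nd x y : a <= x -> x <= y -> y <= b -> F x <= F y.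
  move=> ax xy yb; rewrite /F lerD ?lerD2r ?ler_pM2l ?h_nd//.
  by rewrite f_nd// in_itv/= ?ax ?yb ?(le_trans xy)// (le_trans ax xy).
suff : c' * (b - a) <= F b.
  by move=> /le_trans; apply; rewrite /F lerD2l ler_pM2l.
(* Continuous induction along [[a, b]]: monotonicity of [F] puts [s] in [S], and if [s < b], a
   further point of [S] beyond [s] contradicts the choice of [s]. *)
pose S := [set x | a <= x <= b /\ c' * (x - a) <= F x].
have Sa : S a by split; rewrite ?lexx// subrr mulr0 /F subrr add0r mulr_ge0// ltW.
have Sub : has_ubound S by exists b => x [/andP[]].
set s := sup S.
have as_ : a <= s by exact: ub_le_sup.
have sb : s <= b by apply: ge_sup; [exists a|move=> x [/andP[]]].
have Ss : S s.
  split; first by rewrite as_.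
  rewrite mulrC -ler_pdivlMr// lerBlDr.
  apply: ge_sup; [by exists a|move=> x Sx].
  rewrite -lerBlDr ler_pdivlMr// mulrC.
  case: (Sx) => /andP[ax xb] /le_trans; apply.
  by apply: F_nd => //; exact: ub_le_sup.
move: sb; rewrite le_eqVlt => /predU1P[<-|sb]; first by case: Ss.
suff [y /andP[sy yb] Fy] : exists2 y, s < y <= b & c' * (y - s) <= F y - F s.
  have Sy : S y.
    split; first by rewrite yb (le_trans as_ (ltW sy)).
    by case: Ss => _ Fs; lra.
  by move: (ub_le_sup Sub Sy); rewrite -/s leNgt sy.
(* Inside [U] the term [c * h] alone provides the slope; outside, [s] avoids the exceptional set and
   [f] itself provides it. *)
have [Us|nUs] := pselect (U s).
  have [r /= r0 rU] := (nbhs_ballP _ _).1 (open_nbhs_nbhs (conj oU Us)).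
  pose y := Num.min b (s + r / 2).
  have sy : s < y by rewrite lt_min sb ltrDl divr_gt0.
  have yb : y <= b by rewrite ge_min lexx.
  exists y; first by rewrite sy.
  have -> : F y - F s = f y - f s + c * (h y - h s) by rewrite /F; ring.
  have -> : h y - h s = y - s.
    rewrite /h (@lebesgue_measure_setI_itv_add _ _ _ s)//; first by rewrite addrC addKr.
      exact: ltW.
    move=> t /=; rewrite in_itv/= => /andP[st ty]; apply: rU.
    rewrite /ball/= ltr_norml; move: ty; rewrite le_min => /andP[_ ty].
    by apply/andP; split; lra.
  have : f s <= f y.
    by apply: f_nd; rewrite ?in_itv/= ?as_ ?yb ?ltW// (le_lt_trans as_).
  nra.
have fs : c <= derive1 f s.
  apply: contrapT => fs; apply: nUs; apply/NU/fN => /=.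
  by apply/not_implyP; rewrite as_ sb.
(* A divergent difference quotient has the default limit 0, so the positive value of [derive1 f s]
   is itself evidence of convergence. *)
have dfs : (h^-1 *: (f (h + s) - f s) @[h --> (0:R)^'+]) --> derive1 f s.
  apply: cvg_dnbhs_at_right; apply: cvgNpoint.
  by rewrite -[lim _]/(derive1 f s); apply: lt0r_neq0; exact: lt_le_trans fs.
have : \forall h \near (0:R)^'+, c' < h^-1 *: (f (h + s) - f s).
  by apply: cvgr_gt dfs _ _; exact: lt_le_trans fs.
move=> dfs'.
near (0:R)^'+ => k.
have k0 : 0 < k by near: k; exact: nbhs_right_gt.
have kb : k <= b - s by near: k; apply: nbhs_right_le; rewrite subr_gt0.
exists (s + k); first by rewrite ltrDl k0 -lerBrDl.
have : c' < k^-1 *: (f (k + s) - f s) by near: k.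
rewrite /GRing.scale/= (addrC k s) mulrC ltr_pdivlMr// => fk.
have : c * h s <= c * h (s + k) by rewrite ler_pM2l// h_nd// lerDl ltW.
rewrite /F; lra.
Unshelve. all: by end_near. Qed.

(** * Weak convexity of the penalty *)

Section ThetaInverse.
Context {R : realType} (Theta : R -> R -> R) (lambda : R).
Context (Theta_thr : thresholding Theta) (lambda_ge0 : 0 <= lambda).

Local Notation Tinv := (Theta_inv Theta lambda).
Local Notation L := (L_Theta Theta lambda).
Local Notation pen := (P_Theta Theta lambda).
Local Notation mu := (@lebesgue_measure R).

Lemma has_sup_Theta_le u : 0 <= u -> has_sup [set t | Theta t lambda <= u].
Proof.
move=> u0; have [_ _ Toy T0] := Theta_thr lambda_ge0; split.
  exists 0 => /=; have /andP[_ /le_trans] := T0 0 (lexx _); exact.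
have [M [_ HM]] := (cvgryPgt _).1 Toy u.
exists M => t /= Ttu; rewrite leNgt; apply/negP => Mt.
by move: (HM t Mt); rewrite ltNge Ttu.
Qed.

Lemma Theta_inv_ge u : 0 <= u -> u <= Tinv u.
Proof.
move=> u0; have [_ _ _ T0] := Theta_thr lambda_ge0.
apply: ub_le_sup => /=; first by case: (has_sup_Theta_le u0).
by case/andP: (T0 u u0).
Qed.

Lemma Theta_inv_le u v : 0 <= u -> u <= v -> Tinv u <= Tinv v.
Proof.
move=> u0 uv; apply: ge_sup; first by case: (has_sup_Theta_le u0).
move=> t /= tu; apply: ub_le_sup; last exact: le_trans tu uv.
by case: (has_sup_Theta_le (le_trans u0 uv)).
Qed.

(** Almost everywhere the derivative of [Theta_inv] is at least its essential infimum, and jumps of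
    a nondecreasing function only enlarge its increments. *)
Lemma Theta_inv_slope u v : 0 <= u -> u <= v ->
  (1 - L) * (v - u) <= Tinv v - Tinv u.
Proof.
move=> u0 uv; rewrite /L_Theta subKr.
set e := ess_inf _ _.
(* An infinite [e] has [fine e = 0] and falls under the first case, where monotonicity is enough; in
   the second case [e] is finite. *)
have [e0|e0] := leP (fine e) 0.
  by apply: (@le_trans _ _ 0); [nra|rewrite subr_ge0 Theta_inv_le].
apply: nondecreasing_ae_derive1_ge => //; first exact: ltW.
  move=> x y; rewrite !in_itv/= => /andP[ux _] _; apply: Theta_inv_le.
  exact: le_trans ux.
have : {ae mu, forall x : R,
    (e <= (if (0 <= x)%R then (derive1 Tinv x)%:E else +oo))%E}.
  exact: ess_inf_le.
apply: negligibleS => x /= nx ex; apply: nx => /andP[ux _].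
move: ex; rewrite (le_trans u0 ux) -lee_fin fineK//.
by case: e e0 => //=; rewrite ltxx.
Qed.

(** The compared function is the density of [pen t + L / 2 * t ^+ 2] on the half-line, so its
    monotonicity is the convexity of that function there. *)
Lemma Theta_inv_convexified_le u v : 0 <= u -> u <= v ->
  Tinv u - (1 - L) * u <= Tinv v - (1 - L) * v.
Proof. by move=> u0 uv; have := Theta_inv_slope u0 uv; lra. Qed.

(** Makes [pen t + L / 2 * t ^+ 2] nondecreasing in [|t|], which carries its convexity across 0. *)
Lemma Theta_inv_convexified_ge0 u : 0 <= u -> 0 <= Tinv u - (1 - L) * u.
Proof.
move=> u0; have := Theta_inv_convexified_le (lexx 0) u0.
have := Theta_inv_ge (lexx 0); lra.
Qed.

Lemma Rintegral_affine (a b x y : R) : x <= y ->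
  \int[mu]_(u in `]x, y]) (a + b * u) = a * (y - x) + b * (y ^+ 2 - x ^+ 2) / 2.
Proof.
rewrite le_eqVlt => /predU1P[<-|xy].
  by rewrite set_itvoc0 Rintegral_set0 !subrr !mulr0 mul0r addr0.
pose F (u : R) := a * u + b / 2 * u ^+ 2.
have dF (u : R) : is_derive u (1:R) F (a + b * u).
  apply: is_derive_eq.
  rewrite /GRing.scale/=; lra.
have cf : continuous (fun u : R => a + b * u).
  move=> z; apply: cvgD; first exact: cvg_cst.
  by apply: cvgM; [exact: cvg_cst|exact: cvg_id].
rewrite /Rintegral integral_itv_obnd_cbnd; last first.
  by apply/measurable_EFinP; apply: measurable_funD => //; exact: measurable_funM.
rewrite (@continuous_FTC2 _ _ F)//=; last 3 first.
- exact: continuous_subspaceT.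
- split.
  + by move=> z _; case: (dF z).
  + apply: cvg_at_right_filter; apply: differentiable_continuous.
    by apply/derivable1_diffP; case: (dF x).
  + apply: cvg_at_left_filter; apply: differentiable_continuous.
    by apply/derivable1_diffP; case: (dF y).
- by move=> z _; rewrite derive1E; case: (dF z).
by rewrite /F; lra.
Qed.

Lemma measurable_Theta_inv b : measurable_fun (`]0, b]%classic : set R) Tinv.
Proof.
have : measurable_fun (`]0, b]%classic : set R) (fun u => Tinv (Num.max u 0)).
  apply: nondecreasing_measurable => // u v uv.
  apply: Theta_inv_le; first by rewrite le_max lexx orbT.
  by rewrite ge_max !le_max uv lexx orbT.
apply: eq_measurable_fun; by move=> u; rewrite inE/= in_itv/= => /andP[u0 _]; rewrite max_l// ltW.
Qed.

Lemma integrable_P_Theta b :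
  mu.-integrable `]0, b] (EFin \o (fun u => Tinv u - u)).
Proof.
apply: measurable_bounded_integrable => //.
- by rewrite /= lebesgue_measure_itv/=; case: ifP => // _; rewrite -EFinB ltry.
- by apply: measurable_funB => //; exact: measurable_Theta_inv.
- exists (Tinv b + b); split=> [|M bM u /=]; first exact: num_real.
  rewrite in_itv/= => /andP[/ltW u0 ub]; apply: le_trans (ltW bM).
  have := Theta_inv_ge u0; have := Theta_inv_le u0 ub.
  by move=> h1 h2; rewrite ger0_norm; lra.
Qed.

Lemma P_Theta_itvB x y : 0 <= x -> x <= y ->
  pen y - pen x = \int[mu]_(u in `]x, y]) (Tinv u - u).
Proof.
move=> x0 xy; rewrite /P_Theta !ger0_norm ?(le_trans x0 xy)//.
rewrite Rintegral_itvB//; exact: integrable_P_Theta.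
Qed.

Lemma integrable_affine (a b x y : R) :
  mu.-integrable `]x, y] (EFin \o (fun u => a + b * u)).
Proof.
apply: measurable_bounded_integrable => //.
- by rewrite /= lebesgue_measure_itv/=; case: ifP => // _; rewrite -EFinB ltry.
- by apply: measurable_funD => //; exact: measurable_funM.
- exists (`|a| + `|b| * (`|x| + `|y|)); split=> [|M bM u /=]; first exact: num_real.
  rewrite in_itv/= => /andP[/ltW xu uy]; apply: le_trans (ltW bM).
  apply: le_trans (ler_normD _ _) _; rewrite lerD2l normrM ler_wpM2l//.
  have := ler_norm y; have := ler_norm (- x); rewrite normrN => h1 h2.
  have := normr_ge0 x; have := normr_ge0 y => h3 h4.
  by rewrite ler_norml; lra.
Qed.

Lemma integrable_P_Theta_sub x y : 0 <= x ->
  mu.-integrable `]x, y] (EFin \o (fun u => Tinv u - u)).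
Proof.
move=> x0; apply: integrableS (integrable_P_Theta y) => //.
by apply: subset_itvr; rewrite bnd_simp.
Qed.

(** Integrating the monotonicity of [Tinv u - (1 - L) * u] between [x] and [y] bounds the increment
    of the penalty by that of a parabola; for [y < x] the bound on the integrand and the sign both
    turn round. *)
Lemma P_Theta_subgrad x y : 0 <= x -> 0 <= y ->
  (Tinv x - x) * (y - x) - L / 2 * (y - x) ^+ 2 <= pen y - pen x.
Proof.
move=> x0 y0.
have [xy|/ltW yx] := leP x y.
  rewrite P_Theta_itvB//.
  apply: (@le_trans _ _ (\int[mu]_(u in `]x, y]) (Tinv x - x + L * x + (- L) * u))).
    by rewrite Rintegral_affine//; lra.
  apply: le_Rintegral => //.
  - exact: integrable_affine.
  - exact: integrable_P_Theta_sub.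
  - move=> u /=; rewrite in_itv/= => /andP[/ltW xu _].
    by have := Theta_inv_convexified_le x0 xu; lra.
suff : pen x - pen y <= (Tinv x - x) * (x - y) + L / 2 * (x - y) ^+ 2 by lra.
rewrite P_Theta_itvB//.
apply: (@le_trans _ _ (\int[mu]_(u in `]y, x]) (Tinv x - x + L * x + (- L) * u))).
  apply: le_Rintegral => //.
  - exact: integrable_P_Theta_sub.
  - exact: integrable_affine.
  - move=> u /=; rewrite in_itv/= => /andP[/ltW yu ux].
    by have := Theta_inv_convexified_le (le_trans y0 yu) ux; lra.
by rewrite Rintegral_affine//; lra.
Qed.

Lemma P_Theta_norm t : pen `|t| = pen t.
Proof. by rewrite /P_Theta normr_id. Qed.

Lemma P_Theta_weakly_convex s t e : 0 <= e <= 1 ->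
  pen ((1 - e) * s + e * t)
    <= (1 - e) * pen s + e * pen t + L / 2 * (e * (1 - e) * (t - s) ^+ 2).
Proof.
move=> /andP[e0 e1].
pose G x := pen x + L / 2 * x ^+ 2.
have G_norm x : G `|x| = G x by rewrite /G P_Theta_norm real_normK ?num_real.
suff : G ((1 - e) * s + e * t) <= (1 - e) * G s + e * G t by rewrite /G; lra.
have G_sub x y : 0 <= x -> 0 <= y ->
    (Tinv x - (1 - L) * x) * (y - x) <= G y - G x.
  by move=> x0 y0; have := P_Theta_subgrad x0 y0; rewrite /G; lra.
rewrite -G_norm -[G s]G_norm -[G t]G_norm.
set x := (1 - e) * `|s| + e * `|t|.
have x0 : 0 <= x by rewrite addr_ge0 ?mulr_ge0 ?subr_ge0.
(* [x] is the same convex combination of the absolute values. It dominates [z] by the triangle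
   inequality, and [G] is nondecreasing; the subgradient inequalities at [x], weighted by [1 - e]
   and [e], then cancel their linear terms. *)
apply: (@le_trans _ _ (G x)).
  set z := `|_|; have z0 : 0 <= z by exact: normr_ge0.
  have zx : z <= x.
    apply: le_trans (ler_normD _ _) _; rewrite !normrM (ger0_norm e0).
    by rewrite (@ger0_norm _ (1 - e)) ?subr_ge0.
  have := G_sub _ _ z0 x0; have := Theta_inv_convexified_ge0 z0; nra.
have := G_sub _ _ x0 (normr_ge0 s); have := G_sub _ _ x0 (normr_ge0 t).
set m := Tinv x - _ => ht hs.
have : (1 - e) * (m * (`|s| - x)) <= (1 - e) * (G `|s| - G x).
  by apply: ler_wpM2l; rewrite ?subr_ge0.
have : e * (m * (`|t| - x)) <= e * (G `|t| - G x) by apply: ler_wpM2l.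
have : (1 - e) * (m * (`|s| - x)) + e * (m * (`|t| - x)) = 0.
  by rewrite /x; ring.
lra.
Qed.

End ThetaInverse.

(** * Optimality of fixed points *)

Section DotProduct.
Context {R : realType} {k : nat}.
Implicit Types (u v x : 'cV[R]_k) (a : R).

Lemma dotvC u v : dotv u v = dotv v u.
Proof. by apply: eq_bigr => i _; rewrite mulrC. Qed.

Lemma dotvDl u v x : dotv (u + v) x = dotv u x + dotv v x.
Proof. by rewrite -big_split; apply: eq_bigr => i _; rewrite mxE mulrDl. Qed.

Lemma dotvZl a u x : dotv (a *: u) x = a * dotv u x.
Proof. by rewrite mulr_sumr; apply: eq_bigr => i _; rewrite mxE mulrA. Qed.

Lemma dotvNl u x : dotv (- u) x = - dotv u x.
Proof. by rewrite -scaleN1r dotvZl mulN1r. Qed.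

Lemma dotvDr u v x : dotv x (u + v) = dotv x u + dotv x v.
Proof. by rewrite dotvC dotvDl !(dotvC x). Qed.

Lemma dotvZr a u x : dotv x (a *: u) = a * dotv x u.
Proof. by rewrite dotvC dotvZl dotvC. Qed.

Lemma dotvNr u x : dotv x (- u) = - dotv x u.
Proof. by rewrite dotvC dotvNl dotvC. Qed.

Lemma dotvBr u v x : dotv x (u - v) = dotv x u - dotv x v.
Proof. by rewrite dotvDr dotvNr. Qed.

Lemma dotv0l x : dotv 0 x = 0.
Proof. by rewrite -(scale0r x) dotvZl mul0r. Qed.

Lemma dotv0r x : dotv x 0 = 0.
Proof. by rewrite dotvC dotv0l. Qed.

Lemma dotv_sumr (I : Type) (r : seq I) (F : I -> 'cV[R]_k) x :
  dotv x (\sum_(i <- r) F i) = \sum_(i <- r) dotv x (F i).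
Proof.
by elim/big_rec2: _ => [|i y z _ <-]; rewrite ?dotv0r// dotvDr.
Qed.

Lemma dotv_ge0 u : 0 <= dotv u u.
Proof. by apply: sumr_ge0 => i _; rewrite -expr2 sqr_ge0. Qed.

Lemma dotv_eq0 u : dotv u u = 0 -> u = 0.
Proof.
move=> /eqP; rewrite psumr_eq0 => [/allP u0|i _]; last by rewrite -expr2 sqr_ge0.
apply/colP => i; rewrite mxE; apply/eqP.
by have := u0 i (mem_index_enum _); rewrite /= mulf_eq0 orbb.
Qed.

Lemma l2norm_ge0 u : 0 <= l2norm u. Proof. exact: sqrtr_ge0. Qed.

Lemma sqr_l2norm u : l2norm u ^+ 2 = dotv u u.
Proof. by rewrite sqr_sqrtr// dotv_ge0. Qed.

Lemma D2E u v : D2 u v = dotv (u - v) (u - v) / 2.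
Proof. by rewrite /D2 sqr_l2norm. Qed.

End DotProduct.

Lemma col_dotv_le (R : realType) n p (X : 'M[R]_(n, p)) (rho : R) (j : 'I_p) :
  spectral_norm X <= rho -> dotv (col j X) (col j X) <= rho ^+ 2.
Proof.
move=> Xrho; rewrite -sqr_l2norm.
suff : l2norm (col j X) <= rho.
  by move=> h; rewrite lerXn2r ?nnegrE ?l2norm_ge0// (le_trans (l2norm_ge0 _) h).
apply: le_trans Xrho; apply: ub_le_sup; last first.
  exists (delta_mx j 0); last by rewrite -colE.
  rewrite /= /l2norm /dotv (bigD1 j)//= big1 => [|i ij].
    by rewrite !mxE !eqxx mulr1 addr0 sqrtr1.
  by rewrite !mxE (negbTE ij) mul0r.
(* The supremum dominates its set only once that set is known to be bounded; here every entry of a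
   vector of the unit ball is at most 1 in absolute value. *)
exists (Num.sqrt (\sum_i (\sum_j `|X i j|) ^+ 2)) => _ [u /= u1 <-].
apply: ler_wsqrtr; apply: ler_sum => i _; rewrite -expr2 -real_normK ?num_real//.
rewrite lerXn2r ?nnegrE ?sumr_ge0// mxE; apply: le_trans (ler_norm_sum _ _ _) _.
apply: ler_sum => l _; rewrite normrM ler_piMr//.
apply: le_trans u1; rewrite -sqrtr_sqr ler_wsqrtr// /dotv (bigD1 l)//= -expr2.
by rewrite lerDl sumr_ge0// => m _; rewrite -expr2 sqr_ge0.
Qed.

(** * Directional derivatives and the first-order condition *)

Section DirectionalDerivative.
Context {R : realType} {k : nat}.
Implicit Types (psi : 'cV[R]_k -> R) (b h : 'cV[R]_k).

Lemma ddirP psi b h : dir_differentiable psi ->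
  dquot psi b h e @[e --> 0^'+] --> ddir psi b h.
Proof. by move=> dpsi; exact: dpsi. Qed.

Lemma ddir0 psi b : ddir psi b 0 = 0.
Proof.
rewrite /ddir (_ : dquot psi b 0 = cst 0); first exact: lim_cst.
by apply/funext => e; rewrite /dquot scaler0 addr0 subrr mul0r.
Qed.

Lemma ddirZ psi b h (a : R) : dir_differentiable psi -> 0 < a ->
  ddir psi b (a *: h) = a * ddir psi b h.
Proof.
move=> dpsi a0; apply: cvg_lim => //.
have : a * dquot psi b h (a * e) @[e --> 0^'+] --> a * ddir psi b h.
  apply: cvgMr; apply/cvg_at_rightP => u [u0 ucvg].
  have /cvg_at_rightP := @ddirP psi b h dpsi; apply; split=> [m|].
    exact: mulr_gt0.
  by rewrite -(mulr0 a); apply: cvgMr.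
apply: cvg_trans; apply: near_eq_cvg; near=> e.
have e0 : 0 < e by near: e; exact: nbhs_right_gt.
rewrite /dquot scalerA (mulrC e); field.
by rewrite !gt_eqF.
Unshelve. all: by end_near. Qed.

Lemma Bregman_self psi b : Bregman psi b b = 0.
Proof. by rewrite /Bregman !subrr ddir0 subrr. Qed.

Lemma ddir_grad psi b h : differentiable psi b ->
  ddir psi b h = dotv (grad psi b) h.
Proof.
move=> dpsi.
have -> : dotv (grad psi b) h = 'D_h psi b.
  rewrite deriveE// {2}(matrix_sum_delta h) exchange_big/= big_ord1 linear_sum.
  by apply: eq_bigr => i _; rewrite mxE linearZ/= deriveE// mulrC.
have : derivable psi b h by exact: diff_derivable.
move=> /cvg_dnbhs_at_right dh.
apply: cvg_lim => //; apply: cvg_trans dh.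
apply: near_eq_cvg; near=> e.
by rewrite /dquot /shift/= [b + _]addrC /GRing.scale/= mulrC.
Unshelve. all: by end_near. Qed.

End DirectionalDerivative.

Lemma Bregman_comp (R : realType) n p (X : 'M[R]_(n, p)) (f : 'cV[R]_n -> R) b c :
  Bregman (fun b => f (X *m b)) b c = Bregman f (X *m b) (X *m c).
Proof.
rewrite /Bregman /ddir -mulmxBr.
suff -> : dquot (fun b => f (X *m b)) c (b - c)
  = dquot f (X *m c) (X *m (b - c)) by [].
by apply/funext => e; rewrite /dquot mulmxDr -scalemxAr.
Qed.

Lemma sum_pen_P_Theta_weakly_convex (R : realType) (Theta : R -> R -> R)
    (lambda rho e : R) p (b c : 'cV[R]_p) :
    thresholding Theta -> 0 <= lambda -> 0 <= e <= 1 ->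
  sum_pen (P_Theta Theta lambda) (rho *: (c + e *: (b - c)))
    <= (1 - e) * sum_pen (P_Theta Theta lambda) (rho *: c)
       + e * sum_pen (P_Theta Theta lambda) (rho *: b)
       + e * (1 - e) * (rho ^+ 2 * L_Theta Theta lambda * D2 b c).
Proof.
move=> thr lam0 e01; rewrite D2E /sum_pen /dotv.
rewrite !mulr_suml !mulr_sumr -!big_split/=; apply: ler_sum => i _.
have := P_Theta_weakly_convex thr lam0 (rho * c i 0) (rho * b i 0) e01.
rewrite !mxE.
have -> : (1 - e) * (rho * c i 0) + e * (rho * b i 0) = 
  rho * (c i 0 + e * (b i 0 - c i 0)) by ring.
move=> /le_trans; apply; lra.
Qed.

(** Compare [bhat] with [bhat + e *: h], bound the penalty along the segment by weak convexity,
    divide by [e] and let [e] tend to 0. The Bregman term of [psi] disappears in the limit, being of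
    smaller order than [e]. *)
Lemma fixed_point_first_order (R : realType) p (l psi : 'cV[R]_p -> R)
    (Theta : R -> R -> R) (rho lambda : R) (b bhat : 'cV[R]_p) :
    dir_differentiable l -> dir_differentiable psi ->
    thresholding Theta -> 0 <= lambda ->
    fixed_point l psi Theta rho lambda bhat ->
  l bhat + sum_pen (P_Theta Theta lambda) (rho *: bhat) + Bregman l b bhat
    <= l b + sum_pen (P_Theta Theta lambda) (rho *: b)
       + rho ^+ 2 * L_Theta Theta lambda * D2 b bhat.
Proof.
move=> dl dpsi thr lam0 fp.
set Pb := sum_pen _ (rho *: b); set Ph := sum_pen _ (rho *: bhat).
set D := rho ^+ 2 * _ * _; set h := b - bhat.
(* The vanishing difference is kept as the limit of the contribution of [psi]. *)
suff : 0 <= ddir l bhat h + (Pb - Ph) + D + (ddir psi bhat h - ddir psi bhat h).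
  by rewrite /Bregman -/h; lra.
have lcvg : dquot l bhat h e + (Pb - Ph) + (1 - e) * D
    + (dquot psi bhat h e - ddir psi bhat h) @[e --> 0^'+] -->
    ddir l bhat h + (Pb - Ph) + D + (ddir psi bhat h - ddir psi bhat h).
  apply: cvgD; last by apply: cvgB; [exact: ddirP|exact: cvg_cst].
  apply: cvgD; first by apply: cvgD; [exact: ddirP|exact: cvg_cst].
  rewrite -[X in _ --> X]mul1r -{2}(subr0 1).
  apply: cvgMl; apply: cvgB; first exact: cvg_cst.
  by apply: cvg_at_right_filter; exact: cvg_id.
apply: (cvgr_to_ge lcvg); near=> e.
have e0 : 0 < e by near: e; exact: nbhs_right_gt.
have e1 : e <= 1 by near: e; apply: nbhs_right_le.
have := fp (bhat + e *: h).
rewrite /surrogate Bregman_self addr0 -/Ph.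
have := @sum_pen_P_Theta_weakly_convex R Theta lambda rho e p b bhat thr lam0.
rewrite (ltW e0) e1 -/h -/Ph -/Pb -/D => /(_ isT).
set Pe := sum_pen _ _ => He.
have eh : bhat + e *: h - bhat = e *: h by rewrite addrC addKr.
rewrite /Bregman eh ddirZ// => Hf.
rewrite -(pmulr_rge0 _ e0) /dquot.
have -> : e * ((l (bhat + e *: h) - l bhat) / e + (Pb - Ph) + (1 - e) * D +
   ((psi (bhat + e *: h) - psi bhat) / e - ddir psi bhat h)) =
   (l (bhat + e *: h) - l bhat) + e * (Pb - Ph) + e * (1 - e) * D +
   ((psi (bhat + e *: h) - psi bhat) - e * ddir psi bhat h).
  by field; rewrite gt_eqF.
lra.
Unshelve. all: by end_near. Qed.

(** * Sparse reduction of the noise term *)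

Section OrthogonalFamilies.
Context {R : realType} {n : nat}.

(** Zero members allow the family to keep the index set of the columns, whatever their rank. *)
Definition orthonormal_or_zero s (q : 'I_s -> 'cV[R]_n) : Prop :=
  (forall i j, i != j -> dotv (q i) (q j) = 0) /\
  (forall i, dotv (q i) (q i) = 0 \/ dotv (q i) (q i) = 1).

Lemma dotv_orthogonal_sum s (q : 'I_s -> 'cV[R]_n) (b : 'I_s -> R) :
    orthonormal_or_zero q ->
  dotv (\sum_i b i *: q i) (\sum_i b i *: q i)
    = \sum_i b i ^+ 2 * dotv (q i) (q i).
Proof.
move=> [qo _]; rewrite dotv_sumr; apply: eq_bigr => i _.
rewrite dotvZr dotvC dotv_sumr (bigD1 i)//= big1 => [|j ji].
  by rewrite dotvZr addr0; ring.
by rewrite dotvZr qo ?mulr0// eq_sym.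
Qed.

(* A vector x i that depends on the later ones yields q i = 0. *)
Lemma gram_schmidt s (x : 'I_s -> 'cV[R]_n) :
  exists2 q : 'I_s -> 'cV[R]_n, orthonormal_or_zero q &
    forall a : 'I_s -> R, exists b : 'I_s -> R,
      \sum_i a i *: x i = \sum_i b i *: q i.
Proof.
elim: s x => [|s IH] x.
  exists (fun=> 0); first by split; case.
  by move=> a; exists a; rewrite !big_ord0.
have [q [qo q1] qx] := IH (fun i => x (lift ord0 i)).
pose pr := \sum_i dotv (q i) (x ord0) *: q i.
pose y := x ord0 - pr.
have yq i : dotv (q i) y = 0.
  rewrite dotvBr dotv_sumr (bigD1 i)//= big1 => [|j ji]; last first.
    by rewrite dotvZr qo ?mulr0// eq_sym.
  rewrite dotvZr addr0; case: (q1 i) => qi; last by rewrite qi mulr1 subrr.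
  by rewrite (dotv_eq0 qi) !dotv0l mul0r subrr.
pose z := (l2norm y)^-1 *: y.
pose q' i := if unlift ord0 i is Some j then q j else z.
have q'0 : q' ord0 = z by rewrite /q' unlift_none.
have q'S i : q' (lift ord0 i) = q i by rewrite /q' liftK.
have zq i : dotv (q i) z = 0 by rewrite dotvZr yq mulr0.
exists q'.
  split=> [i j|i].
    case: (unliftP ord0 i) => [i'|] ->; case: (unliftP ord0 j) => [j'|] -> ij.
    - by rewrite !q'S qo//; apply: contra ij => /eqP->.
    - by rewrite q'S q'0 zq.
    - by rewrite q'S q'0 dotvC zq.
    - by rewrite eqxx in ij.
  case: (unliftP ord0 i) => [i'|] ->; first by rewrite q'S; exact: q1.
  rewrite q'0 dotvZl dotvZr -sqr_l2norm.
  have [->|y0] := eqVneq (l2norm y) 0; [left|right].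
    by rewrite expr0n /= !mulr0.
  by field.
move=> a; have [b ab] := qx (fun i => a (lift ord0 i)).
exists (fun i => if unlift ord0 i is Some j
  then b j + a ord0 * dotv (q j) (x ord0) else a ord0 * l2norm y).
rewrite !big_ord_recl unlift_none q'0 ab.
under [in RHS]eq_bigr do rewrite liftK q'S scalerDl -scalerA.
rewrite big_split/= -scaler_sumr -/pr [RHS]addrCA [LHS]addrC; congr (_ + _).
have -> : (a ord0 * l2norm y) *: z = a ord0 *: y.
  rewrite /z scalerA; have [y0|y0] := eqVneq (l2norm y) 0; last by rewrite mulfK.
  by rewrite [y]dotv_eq0 ?scaler0// -sqr_l2norm y0 expr0n.
by rewrite -scalerDr subrK.
Qed.

(** Complete the square in each coefficient [b i]; the remaining maximum no longer involves [b], and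
    zero members contribute nothing to the left side. *)
Lemma quadratic_orthogonal_le s (q : 'I_s -> 'cV[R]_n) (b : 'I_s -> R)
    (e : 'cV[R]_n) (d : R) : orthonormal_or_zero q -> 0 < d ->
  let y := \sum_i b i *: q i in
  dotv e y - d / 2 * dotv y y <= (\sum_i dotv e (q i) ^+ 2) / (2 * d).
Proof.
move=> qo d0; rewrite /= dotv_orthogonal_sum// dotv_sumr.
rewrite mulr_sumr -sumrB mulr_suml; apply: ler_sum => i _.
rewrite dotvZr; case: (qo.2 i) => qi.
  by rewrite (dotv_eq0 qi) !dotv0r !mulr0 subrr expr0n /= mul0r.
set x := dotv e (q i); rewrite qi mulr1 -subr_ge0.
have -> : x ^+ 2 / (2 * d) - (b i * x - d / 2 * b i ^+ 2)
    = (x - d * b i) ^+ 2 / (2 * d) by field; rewrite gt_eqF.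
by rewrite divr_ge0 ?sqr_ge0// mulr_ge0// ltW.
Qed.

End OrthogonalFamilies.

(** * Reduction to hard-thresholded vectors *)

Section HardThresholding.
Context {R : realType} {n p : nat} (X : 'M[R]_(n, p)) (e : 'cV[R]_n).
Context (rho lambda delta vartheta : R).
Context (rho_gt0 : 0 < rho) (lambda_ge0 : 0 <= lambda) (delta_gt0 : 0 < delta).
Context (delta_le : delta <= vartheta).
Context (X_le : forall j : 'I_p, dotv (col j X) (col j X) <= rho ^+ 2).

Definition penalized_noise (b : 'cV[R]_p) : R :=
  dotv e (X *m b) - delta / 2 * dotv (X *m b) (X *m b)
  - vartheta * sum_pen (P_H lambda) (rho *: b).

Lemma P_H0 : P_H lambda 0 = 0.
Proof.
rewrite /P_H normr0; case: ltP => [_|l0]; first by lra.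
by have -> : lambda = 0; [apply/le_anti; rewrite l0|lra].
Qed.

Lemma penalized_noise_coord (b : 'cV[R]_p) j (s : R) :
  penalized_noise (b + s *: delta_mx j 0) - penalized_noise b =
  s * (dotv e (col j X) - delta * dotv (X *m b) (col j X))
  - delta / 2 * s ^+ 2 * dotv (col j X) (col j X)
  - vartheta * (P_H lambda (rho * (b j 0 + s)) - P_H lambda (rho * b j 0)).
Proof.
rewrite /penalized_noise mulmxDr -scalemxAr -colE.
rewrite !(dotvDl, dotvDr, dotvZl, dotvZr) (dotvC (col j X) (X *m b)).
have -> : sum_pen (P_H lambda) (rho *: (b + s *: delta_mx j 0)) =
   sum_pen (P_H lambda) (rho *: b)
   + (P_H lambda (rho * (b j 0 + s)) - P_H lambda (rho * b j 0)).
  rewrite /sum_pen (bigD1 j)//= [in RHS](bigD1 j)//= !mxE !eqxx mulr1.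
  rewrite [X in _ + X = _](eq_bigr (fun i => P_H lambda ((rho *: b) i 0))).
    by ring.
  by move=> i ij; rewrite !mxE (negbTE ij) mulr0 addr0.
by field.
Qed.

(* On either side of 0 the objective is convex in the j-th coordinate while it
   is below the threshold, because delta |X_j|^2 <= vartheta rho^2; hence moving
   it to one of the two ends of that range does not decrease the objective. *)
Lemma hard_threshold_coord (b : 'cV[R]_p) j : exists2 s : R,
    penalized_noise b <= penalized_noise (b + s *: delta_mx j 0) &
    b j 0 + s = 0 \/ lambda <= `|rho * (b j 0 + s)|.
Proof.
set t := b j 0; have [rt|rt] := leP lambda `|rho * t|.
  by exists 0; rewrite ?scale0r !addr0//; right.
have [t0|t0] := eqVneq t 0.
  by exists 0; rewrite ?scale0r !addr0//; left.
pose u := `|t|; pose m := lambda / rho; pose sg := Num.sg t.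
have u0 : 0 < u by rewrite normr_gt0.
have tE : t = sg * u by rewrite mulr_sg_norm.
have sg2 : sg ^+ 2 = 1 by rewrite sqr_sg t0.
have lm : lambda = rho * m by rewrite mulrC divfK// gt_eqF.
have um : u < m by rewrite ltr_pdivlMr// mulrC -(gtr0_norm rho_gt0) -normrM.
have m0 : 0 < m by exact: lt_trans um.
have PHt : P_H lambda (rho * t) = rho ^+ 2 * (m * u - u ^+ 2 / 2).
  rewrite /P_H rt exprMn -(real_normK (num_real t)) -/u normrM gtr0_norm// -/u lm.
  lra.
have PHm : P_H lambda (rho * (t + sg * (m - u))) = rho ^+ 2 * m ^+ 2 / 2.
  have -> : rho * (t + sg * (m - u)) = sg * lambda by rewrite tE lm; ring.
  rewrite /P_H normrM normr_sg t0 mul1r ger0_norm// ltxx lm; ring.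
set g := dotv e (col j X) - delta * dotv (X *m b) (col j X).
set q := dotv (col j X) (col j X).
have A : penalized_noise (b + (- t) *: delta_mx j 0) - penalized_noise b =
    - (sg * u) * g - delta / 2 * u ^+ 2 * q + vartheta * rho ^+ 2 * (m * u - u ^+ 2 / 2).
  rewrite penalized_noise_coord -/t subrr mulr0 P_H0 PHt -/g -/q sqrrN.
  rewrite -(real_normK (num_real t)) -/u {1}tE; by field.
have B : penalized_noise (b + (sg * (m - u)) *: delta_mx j 0) - penalized_noise b =
    sg * (m - u) * g - delta / 2 * (m - u) ^+ 2 * q
    - vartheta * rho ^+ 2 * ((m - u) ^+ 2 / 2).
  rewrite penalized_noise_coord -/t PHm PHt -/g -/q exprMn sg2; by field.
(* The coordinate [t] is the mean of 0 and [sg * m] with weights proportional to [m - u] and [u].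
   With these weights the terms in [g] cancel, and what is left has the sign of
   [vartheta * rho ^+ 2 - delta * q]. *)
have AB : 0 <= (m - u) * (penalized_noise (b + (- t) *: delta_mx j 0) - penalized_noise b)
    + u * (penalized_noise (b + (sg * (m - u)) *: delta_mx j 0) - penalized_noise b).
  rewrite A B.
  have -> : forall w, (m - u) * (- (sg * u) * g - delta / 2 * u ^+ 2 * q + w)
   + u * (sg * (m - u) * g - delta / 2 * (m - u) ^+ 2 * q
      - vartheta * rho ^+ 2 * ((m - u) ^+ 2 / 2)) =
    (m - u) * w - u * (vartheta * rho ^+ 2 * ((m - u) ^+ 2 / 2))
    - u * (m - u) * m / 2 * (delta * q) by move=> w; field.
  have -> : (m - u) * (vartheta * rho ^+ 2 * (m * u - u ^+ 2 / 2)) -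
   u * (vartheta * rho ^+ 2 * ((m - u) ^+ 2 / 2)) - u * (m - u) * m / 2 * (delta * q)
    = u * (m - u) * m / 2 * (vartheta * rho ^+ 2 - delta * q) by field.
  rewrite mulr_ge0//.
    by rewrite !mulr_ge0 ?invr_ge0// ?subr_ge0 ltW.
  rewrite subr_ge0 ler_pM ?dotv_ge0 ?X_le//; exact: ltW.
have [A0|A0] := leP 0 (penalized_noise (b + (- t) *: delta_mx j 0) - penalized_noise b).
  by exists (- t); [rewrite -subr_ge0|left; rewrite subrr].
exists (sg * (m - u)).
  rewrite -subr_ge0 -(pmulr_rge0 _ u0); apply: le_trans AB _.
  by rewrite gerDr mulr_ge0_le0 ?ltW// subr_gt0.
right; have -> : rho * (t + sg * (m - u)) = sg * lambda by rewrite tE lm; ring.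
by rewrite normrM normr_sg t0 mul1r ger0_norm.
Qed.

Lemma hard_threshold (b : 'cV[R]_p) : exists2 c : 'cV[R]_p,
    penalized_noise b <= penalized_noise c &
    forall j, c j 0 = 0 \/ lambda <= `|rho * c j 0|.
Proof.
suff H k : exists2 c : 'cV[R]_p, penalized_noise b <= penalized_noise c &
    forall j : 'I_p, (j < k)%N -> c j 0 = 0 \/ lambda <= `|rho * c j 0|.
  by have [c bc ct] := H p; exists c => // j; exact: ct.
elim: k => [|k [c bc ct]]; first by exists b.
have [kp|pk] := ltnP k p; last first.
  by exists c => // j _; apply: ct; exact: leq_trans pk.
have [s cs st] := hard_threshold_coord c (Ordinal kp).
exists (c + s *: delta_mx (Ordinal kp) 0) => [|j]; first exact: le_trans cs.
rewrite ltnS leq_eqVlt => /predU1P[jk|jk].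
  have -> : j = Ordinal kp by exact: val_inj.
  by rewrite !mxE !eqxx mulr1.
rewrite !mxE andbT; have -> : (j == Ordinal kp) = false.
  by apply/negbTE; rewrite -val_eqE/= ltn_eqF.
by rewrite mulr0 addr0; exact: ct.
Qed.

(** [S] is the support of the thresholded vector: each of its coordinates pays the full
    [lambda ^+ 2 / 2], and the fitted vector lies in the span of the columns in [S], where the
    quadratic bound applies. *)
Lemma penalized_noise_le (q : forall S : {set 'I_p}, 'I_#|S| -> 'cV[R]_n)
    (q_orth : forall S, orthonormal_or_zero (q S))
    (q_span : forall (S : {set 'I_p}) (a : 'I_#|S| -> R), exists b : 'I_#|S| -> R,
       \sum_i a i *: col (enum_val i) X = \sum_i b i *: q S i)
    (b : 'cV[R]_p) : exists S : {set 'I_p},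
  penalized_noise b <= (\sum_i dotv e (q S i) ^+ 2) / (2 * delta)
    - vartheta * lambda ^+ 2 / 2 * #|S|%:R.
Proof.
have [c bc ct] := hard_threshold b.
pose S := [set j | c j 0 != 0]%SET; exists S; apply: le_trans bc _.
rewrite /penalized_noise lerB//.
  have [a ca] := q_span S (fun i => c (enum_val i) 0).
  have -> : X *m c = \sum_i a i *: q S i.
    rewrite -ca -(big_enum_val (fun j => c j 0 *: col j X))/=.
    rewrite [RHS](_ : _ = \sum_j c j 0 *: col j X).
      apply/colP => i; rewrite mxE summxE; apply: eq_bigr => j _.
      by rewrite !mxE mulrC.
    rewrite [RHS](bigID (mem S))/= [X in _ + X]big1 ?addr0// => j.
    by rewrite inE negbK => /eqP ->; rewrite scale0r.
  exact: quadratic_orthogonal_le.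
rewrite -mulrA -mulrA ler_wpM2l//; first by rewrite (le_trans _ delta_le)// ltW.
rewrite /sum_pen (bigID (mem S))/= [X in _ + X]big1 ?addr0 => [|j]; last first.
  by rewrite inE negbK mxE => /eqP ->; rewrite mulr0 P_H0.
rewrite (eq_bigr (fun=> lambda ^+ 2 / 2)) => [|j]; last first.
  rewrite inE mxE => cj; rewrite /P_H; case: (ct j) => [cj0|].
    by rewrite cj0 eqxx in cj.
  by rewrite leNgt => /negbTE ->.
by rewrite sumr_const -[X in _ <= X]mulr_natr; lra.
Qed.

End HardThresholding.

(** * Sub-Gaussian projections *)

Section LatticeNet.
Context {R : realType}.

(** Ordinals shifted by [M] encode integers around 0, so that the net is indexed by a finite
    type. *)
Definition lattice_coord M (k : nat) : R := k%:R - M%:R.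

(** With truncated subtraction the exponent is the distance from [k] to [M]: the sum is part of two
    geometric series with total [1 + 1 + 1]. *)
Lemma sum_half_distn_le (M m : nat) :
  \sum_(k < m) (2^-1 : R) ^+ ((k - M) + (M - k)) <= 3.
Proof.
have H1 j : (j <= M)%N ->
    \sum_(k < j) (2^-1 : R) ^+ ((k - M) + (M - k)) <= 2^-1 ^+ (M - j).
  elim: j => [_|j IH jM]; first by rewrite big_ord0 exprn_ge0.
  rewrite big_ord_recr/=; apply: le_trans (lerD (IH (ltnW jM)) (lexx _)) _.
  have -> : (j - M + (M - j) = (M - j.+1).+1)%N by lia.
  have -> : (M - j = (M - j.+1).+1)%N by lia.
  by rewrite exprS; lra.
have H2 j : \sum_(k < M + j) (2^-1 : R) ^+ ((k - M) + (M - k)) <= 3 - 2 * 2^-1 ^+ j.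
  elim: j => [|j IH].
    by rewrite addn0; apply: le_trans (H1 M (leqnn _)) _; rewrite subnn expr0; lra.
  rewrite addnS big_ord_recr/=; apply: le_trans (lerD IH (lexx _)) _.
  have -> : (M + j - M + (M - (M + j)) = j)%N by lia.
  by rewrite exprS; lra.
have [mM|Mm] := leqP m M.
  apply: le_trans (H1 m mM) _; apply: (@le_trans _ _ 1); last by lra.
  by rewrite exprn_ile1//; lra.
have := H2 (m - M)%N; rewrite subnKC ?(ltnW Mm)// => /le_trans; apply.
have : 0 <= 2^-1 ^+ (m - M) :> R by rewrite exprn_ge0.
lra.
Qed.

(* The weights 2^-|z_1| ... 2^-|z_s| have total mass at most 3^s. *)
Lemma card_lattice_ball_le s M m B :
  (\sum_(z : {ffun 'I_s -> 'I_m} |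
      \sum_i lattice_coord M (z i) ^+ 2 <= B%:R) 1) <= 2 ^+ B * 3 ^+ s :> R.
Proof.
pose N (k : nat) := ((k - M) + (M - k))%N.
have NE k : lattice_coord M k ^+ 2 = (N k)%:R ^+ 2.
  rewrite /lattice_coord /N; have [kM|Mk] := leqP k M.
    have -> : (k - M + (M - k) = M - k)%N by lia.
    by rewrite natrB// -sqrrN opprB.
  have -> : (k - M + (M - k) = k - M)%N by lia.
  by rewrite natrB// ltnW.
apply: (@le_trans _ _ (\sum_(z : {ffun 'I_s -> 'I_m})
    2 ^+ B * \prod_i (2^-1 ^+ N (z i)))).
  rewrite [leRHS](bigID (fun z : {ffun 'I_s -> 'I_m} =>
    \sum_i lattice_coord M (z i) ^+ 2 <= B%:R))/=.
  rewrite -[leLHS]addr0 lerD//; last first.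
    by apply: sumr_ge0 => z _; rewrite mulr_ge0 ?prodr_ge0// => i _; rewrite exprn_ge0.
  apply: ler_sum => z zB; rewrite -expr_sum.
  (* An integer is at most its square in absolute value, so on the ball the product of the weights
     is at least [2^-B]. *)
  have NB : (\sum_i N (z i) <= B)%N.
    rewrite -(@ler_nat R) natr_sum; apply: le_trans zB; apply: ler_sum => i _.
    rewrite NE -natrX ler_nat; nia.
  rewrite -(subnK NB) exprD -mulrA -exprMn mulfV// expr1n mulr1.
  by rewrite exprn_ege1//; lra.
rewrite -mulr_sumr ler_wpM2l ?exprn_ge0//.
rewrite -(bigA_distr_bigA (fun (_ : 'I_s) (k : 'I_m) => (2^-1 : R) ^+ N k)).
rewrite -[s in leRHS](card_ord s) -prodr_const; apply: ler_prod => i _.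
by rewrite sum_half_distn_le sumr_ge0// => k _; rewrite exprn_ge0.
Qed.

(* Witness: z = floor(2 sqrt s x / |x|). *)
Lemma lattice_net_exists s (x : 'I_s -> R) :
  exists2 z : {ffun 'I_s -> 'I_(4 * s).+1},
    \sum_i lattice_coord (2 * s) (z i) ^+ 2 <= (10 * s)%:R &
    s%:R * (\sum_i x i ^+ 2)
      <= (\sum_i x i * lattice_coord (2 * s) (z i)) ^+ 2.
Proof.
set N2 := \sum_i x i ^+ 2.
have N2_ge0 : 0 <= N2 by apply: sumr_ge0 => i _; rewrite sqr_ge0.
have [N20|N20] := eqVneq N2 0.
  have h : (2 * s < (4 * s).+1)%N by lia.
  exists [ffun=> Ordinal h]; last by rewrite N20 mulr0 sqr_ge0.
  by rewrite big1// => i _; rewrite ffunE /lattice_coord/= subrr expr0n.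
have N2_gt0 : 0 < N2 by rewrite lt_def N20.
have s0 : (0 < s)%N.
  rewrite lt0n; apply: contra N20 => /eqP s0; rewrite /N2 big1// => i _.
  by exfalso; have := ltn_ord i; lia.
pose N := Num.sqrt N2; pose r : R := Num.sqrt s%:R.
have N0 : 0 < N by rewrite sqrtr_gt0.
have NN : N ^+ 2 = N2 by rewrite sqr_sqrtr.
have r0 : 0 < r by rewrite sqrtr_gt0 ltr0n.
have rr : r ^+ 2 = s%:R by rewrite sqr_sqrtr.
pose a := r / N; have a0 : 0 < a by rewrite divr_gt0.
have a2 : a ^+ 2 * N2 = s%:R by rewrite exprMn exprVn NN rr divfK.
have s1 : 1 <= s%:R :> R by rewrite ler1n.
(* The square root of [s] is at most [s], so the integer shift [2 * s] brings all rounded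
   coordinates into [[0, 4 * s]]. *)
have w_le i : `|a * x i| <= s%:R.
  have : (a * x i) ^+ 2 <= s%:R.
    rewrite exprMn -a2 ler_pM2l ?exprn_gt0// /N2 (bigD1 i)//= lerDl.
    by apply: sumr_ge0 => j _; rewrite sqr_ge0.
  rewrite -real_normK ?num_real// => h; have := normr_ge0 (a * x i) => h0.
  by rewrite leNgt; apply/negP => h1; nra.
pose y i := 2 * (a * x i) + (2 * s)%:R.
have y0 i : 0 <= y i by have := w_le i; rewrite /y ler_norml natrM => /andP[]; lra.
pose k i := Num.truncn (y i).
have k_lt i : (k i < (4 * s).+1)%N.
  have /andP[ky _] := truncn_itv (y0 i).
  rewrite ltnS -(@ler_nat R); apply: le_trans ky _.
  by have := w_le i; rewrite /y ler_norml !natrM => /andP[_]; lra.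
pose z := [ffun i => Ordinal (k_lt i)].
pose d i := 2 * (a * x i) - lattice_coord (2 * s) (z i).
have d01 i : 0 <= d i <= 1.
  have /andP[k1] := truncn_itv (y0 i); rewrite -natr1 => k2.
  by rewrite /d /lattice_coord ffunE/=; move: k1 k2; rewrite -/(k i) /y; lra.
have zE i : lattice_coord (2 * s) (z i) = 2 * (a * x i) - d i by rewrite /d; ring.
exists z.
  (* From [(2 w - d)^2 <= 8 w^2 + 2] with [0 <= d <= 1]; the total is [8 s + 2 s]. *)
  apply: (@le_trans _ _ (\sum_i (8 * a ^+ 2 * x i ^+ 2 + 2))).
    apply: ler_sum => i _; rewrite zE; have := sqr_ge0 (2 * (a * x i) + d i).
    have /andP[d0 d1] := d01 i; nra.
  rewrite big_split/= -mulr_sumr -/N2 -mulrA a2 sumr_const card_ord -mulr_natr.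
  by rewrite natrM; lra.
have rN : r * N <= \sum_i x i * lattice_coord (2 * s) (z i).
  (* As [a * N2] and [s / a] both equal [r * N], these lower bounds sum to [3/2 r N - 1/2 r N]. *)
  apply: (@le_trans _ _ (\sum_i (3 / 2 * a * x i ^+ 2 - (2 * a)^-1))).
    rewrite sumrB -mulr_sumr -/N2 sumr_const card_ord -[X in _ - X]mulr_natr -NN -rr /a.
    rewrite le_eqVlt; apply/orP; left; apply/eqP; field.
    by rewrite !gt_eqF.
  apply: ler_sum => i _; rewrite zE; have /andP[d0 d1] := d01 i.
  rewrite -subr_ge0.
  have -> : x i * (2 * (a * x i) - d i) - (3 / 2 * a * x i ^+ 2 - (2 * a)^-1)
      = ((a * x i - d i) ^+ 2 + (1 - d i ^+ 2)) / (2 * a) by field; rewrite gt_eqF.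
  rewrite divr_ge0//; last by rewrite mulr_ge0// ltW.
  by rewrite addr_ge0 ?sqr_ge0// subr_ge0 expr_le1.
rewrite -rr -NN -exprMn lerXn2r// nnegrE; first by rewrite mulr_ge0// ltW.
by apply: le_trans rN; rewrite mulr_ge0// ltW.
Qed.

(** The net point adapted to [x] already gives one term that is large enough. Summing over the whole
    net makes the bound independent of [x], hence integrable term by term. *)
Lemma expR_sum_sqr_le s (x : 'I_s -> R) (c : R) : (0 < s)%N -> 0 < c ->
  expR ((\sum_i x i ^+ 2) / c) <=
  \sum_(z : {ffun 'I_s -> 'I_(4 * s).+1} |
      \sum_i lattice_coord (2 * s) (z i) ^+ 2 <= (10 * s)%:R)
    expR ((\sum_i x i * lattice_coord (2 * s) (z i)) ^+ 2 / (s%:R * c)).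
Proof.
move=> s0 c0; have [z zB zx] := lattice_net_exists x.
rewrite (bigD1 z)//=.
apply: (@le_trans _ _ (expR ((\sum_i x i * lattice_coord (2 * s) (z i)) ^+ 2
    / (s%:R * c)))).
  by rewrite ler_expR invfM mulrA ler_pM2r ?invr_gt0// ler_pdivlMr ?ltr0n// mulrC.
by rewrite lerDl sumr_ge0// => *; exact: expR_ge0.
Qed.

End LatticeNet.

Lemma sum_expr_card (R : comPzRingType) (I : finType) (q : R) :
  \sum_(S : {set I}) q ^+ #|S| = (1 + q) ^+ #|I|.
Proof.
rewrite addrC -prodr_const bigA_distr; apply: eq_bigr => S _.
by rewrite -big_mkcond/= prodr_const.
Qed.

(** Strict inequality provides an admissible scale below [c] without asking that the infimum be
    attained; a larger scale only lowers the exponential. *)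
Lemma psi2_norm_lt_integral (R : realType) d (T : measurableType d)
    (P : probability T R) (xi : T -> R) (c : R) :
    measurable_fun setT xi -> (psi2_norm P xi < c%:E)%E ->
  (\int[P]_w (expR (xi w ^+ 2 / c ^+ 2))%:E <= 2%:E)%E.
Proof.
move=> mxi /ereal_inf_lt[_ [s [s0 Es] <-]]; rewrite lte_fin => sc.
move: Es; rewrite unlock => Es; apply: le_trans Es.
have mexp (a : R) : measurable_fun setT (fun w => (expR (xi w ^+ 2 / a))%:E).
  apply/measurable_EFinP; apply: measurableT_comp => //.
  by apply: measurable_funM => //; exact: measurable_funX.
apply: ge0_le_integral => // w _; rewrite ?lee_fin ?expR_ge0//.
rewrite ler_expR ler_wpM2l ?sqr_ge0// lef_pV2 ?posrE ?exprn_gt0//.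
  by rewrite lerXn2r ?nnegrE// ltW// (lt_trans s0 sc).
exact: lt_trans sc.
Qed.

(** * Exponential moments and excesses of projected noise *)

Section SubGaussianNoise.
Context {R : realType} {d : measure_display} {T : measurableType d}.
Context (P : probability T R) {n : nat} (xi : T -> 'cV[R]_n) (sigma : R).
Context (xi_sub : subgaussian_vec P xi sigma) (sigma_ge0 : 0 <= sigma).

Lemma measurable_dotv a : measurable_fun setT (fun w => dotv (xi w) a).
Proof.
apply: measurable_sum => i; apply: measurable_funM => //.
by have [mxi _] := xi_sub; exact: mxi.
Qed.

Lemma measurable_sum_dotv_sqr s (q : 'I_s -> 'cV[R]_n) :
  measurable_fun setT (fun w => \sum_i dotv (xi w) (q i) ^+ 2).
Proof.
by apply: measurable_sum => i; apply: measurable_funX; exact: measurable_dotv.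
Qed.

Lemma subgaussian_integral_le a (c : R) : sigma * l2norm a < c ->
  (\int[P]_w (expR (dotv (xi w) a ^+ 2 / c ^+ 2))%:E <= 2%:E)%E.
Proof.
move=> ac; apply: psi2_norm_lt_integral; first exact: measurable_dotv.
by apply: le_lt_trans (xi_sub.2 a) _; rewrite lte_fin.
Qed.

(** Every net vector has norm at most the square root of [10 * s], so its exponential moment at
    scale [c] is at most 2; the net has at most [2 ^+ (10 * s) * 3 ^+ s] points. *)
Lemma integral_expR_projection_le s (q : 'I_s -> 'cV[R]_n) (tau : R) :
    orthonormal_or_zero q -> sigma < tau ->
  (\int[P]_w (expR ((\sum_i dotv (xi w) (q i) ^+ 2) / (10 * tau ^+ 2)))%:E
    <= (2 * (2 ^+ 10 * 3) ^+ s)%:E)%E.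
Proof.
move=> qo st; have tau0 : 0 < tau by exact: le_lt_trans st.
have c0 : 0 < 10 * tau ^+ 2 by rewrite mulr_gt0// exprn_gt0.
(* An empty family is treated apart, as the scale [c] would be 0. *)
have [s0|s0] := posnP s.
  rewrite (eq_integral (cst 1%:E)) => [|w _]; last first.
    by rewrite big1 ?mul0r ?expR0// => i _; exfalso; have := ltn_ord i; lia.
  by rewrite integral_cst// [X in (_ * X)%E]probability_setT mule1 lee_fin s0 expr0; lra.
pose B (z : {ffun 'I_s -> 'I_(4 * s).+1}) :=
  \sum_i lattice_coord (2 * s) (z i) ^+ 2 <= (10 * s)%:R :> R.
pose a (z : {ffun 'I_s -> 'I_(4 * s).+1}) :=
  \sum_i lattice_coord (2 * s) (z i) *: q i.
pose c : R := Num.sqrt (10 * s)%:R * tau.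
have c2 : c ^+ 2 = s%:R * (10 * tau ^+ 2).
  by rewrite exprMn sqr_sqrtr// natrM; ring.
have mexp b : measurable_fun setT (fun w => (expR (dotv (xi w) b ^+ 2 / c ^+ 2))%:E).
  apply/measurable_EFinP; apply: measurableT_comp => //.
  apply: measurable_funM => //; apply: measurable_funX; exact: measurable_dotv.
apply: (@le_trans _ _
  (\int[P]_w (\sum_(z <- [seq z <- index_enum _ | B z])
     (expR (dotv (xi w) (a z) ^+ 2 / c ^+ 2))%:E))%E).
  apply: ge0_le_integral => //.
  - apply/measurable_EFinP; apply: measurableT_comp => //.
    apply: measurable_funM => //; exact: measurable_sum_dotv_sqr.
  - by apply: emeasurable_sum => z; exact: mexp.
  - move=> w _; rewrite big_filter sumEFin lee_fin.
    apply: le_trans (expR_sum_sqr_le _ s0 c0) _.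
    apply: ler_sum => z _; rewrite c2 ler_expR /a dotv_sumr.
    rewrite le_eqVlt; apply/orP; left; apply/eqP; congr (_ ^+ 2 / _).
    by apply: eq_bigr => i _; rewrite dotvZr mulrC.
rewrite ge0_integral_sum// big_filter.
apply: (@le_trans _ _ (\sum_(z | B z) 2%:E)%E).
  apply: lee_sum => z Bz; apply: subgaussian_integral_le.
  apply: (@le_lt_trans _ _ (sigma * Num.sqrt (10 * s)%:R)).
    rewrite ler_wpM2l// /l2norm ler_wsqrtr//; apply: le_trans Bz.
    rewrite dotv_orthogonal_sum//; apply: ler_sum => i _.
    by rewrite ler_piMr ?sqr_ge0//; case: (qo.2 i) => ->.
  by rewrite /c mulrC ltr_pM2l// sqrtr_gt0 ltr0n muln_gt0.
rewrite sumEFin lee_fin -[X in \sum_(_ | _) X]mulr1 -mulr_sumr ler_wpM2l//.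
apply: le_trans (card_lattice_ball_le _ _ _ _) _.
by rewrite exprMn exprM.
Qed.

(** By [1 + x <= expR x], the excess of [y] over [t] is at most [c * expR ((y - t) / c)], here with
    [c = 10 * tau ^+ 2]. *)
Lemma integral_excess_tau_le s (q : 'I_s -> 'cV[R]_n) (tau t : R) :
    orthonormal_or_zero q -> sigma < tau ->
  (\int[P]_w (Num.max ((\sum_i dotv (xi w) (q i) ^+ 2) - t) 0)%:E
    <= (10 * tau ^+ 2 * expR (- t / (10 * tau ^+ 2))
        * (2 * (2 ^+ 10 * 3) ^+ s))%:E)%E.
Proof.
move=> qo st; have tau0 : 0 < tau by exact: le_lt_trans st.
set c := 10 * tau ^+ 2; have c0 : 0 < c by rewrite mulr_gt0// exprn_gt0.
have k0 : 0 <= c * expR (- t / c) by rewrite mulr_ge0 ?expR_ge0// ltW.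
have mY := measurable_sum_dotv_sqr q.
have mE : measurable_fun setT
    (fun w => (expR ((\sum_i dotv (xi w) (q i) ^+ 2) / c))%:E).
  by apply/measurable_EFinP; apply: measurableT_comp => //; exact: measurable_funM.
apply: (@le_trans _ _ (\int[P]_w ((c * expR (- t / c))%:E
    * (expR ((\sum_i dotv (xi w) (q i) ^+ 2) / c))%:E))%E).
  apply: ge0_le_integral => //.
  - by move=> w _; rewrite lee_fin le_max lexx orbT.
  - by apply/measurable_EFinP; apply: measurable_maxr => //; exact: measurable_funB.
  - exact: measurable_funeM.
  - move=> w _; rewrite -EFinM lee_fin; set y := \sum_i _.
    rewrite -mulrA -expRD -mulrDl addrC ge_max; apply/andP; split; last first.
      by rewrite mulr_ge0 ?expR_ge0// ltW.
    rewrite mulrC -ler_pdivrMr//; apply: le_trans (expR_ge1Dx _); lra.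
rewrite ge0_integralZl//.
rewrite [X in (_ <= X)%E]EFinM; apply: lee_wpmul2l; first by rewrite lee_fin.
exact: integral_expR_projection_le.
Qed.

Lemma integral_excess_le s (q : 'I_s -> 'cV[R]_n) (a : R) :
    orthonormal_or_zero q -> 0 <= a ->
  (\int[P]_w (Num.max ((\sum_i dotv (xi w) (q i) ^+ 2)
      - sigma ^+ 2 * a * s%:R) 0)%:E
    <= (80 * sigma ^+ 2 * (2 ^+ 10 * 3 * expR (- (a / 40))) ^+ s)%:E)%E.
Proof.
(* For positive [sigma] the choice [tau = 2 * sigma] gives the constants 80 and 40. For [sigma = 0]
   any positive [tau] is admissible, and the chosen one makes the bound equal to [e]. *)
move=> qo a0; have [s0|s0] := eqVneq sigma 0.
  rewrite s0 expr0n /= !mul0r mulr0 mul0r; apply/lee_addgt0Pr => e e0.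
  rewrite add0e; set B : R := (2 ^+ 10 * 3) ^+ s.
  have B0 : 0 < B by rewrite exprn_gt0// mulr_gt0// exprn_gt0.
  have t0 : 0 < e / (20 * B) by rewrite divr_gt0// mulr_gt0.
  have := @integral_excess_tau_le s q (Num.sqrt (e / (20 * B))) 0 qo.
  rewrite s0 sqrtr_gt0 t0 => /(_ isT) /le_trans; apply.
  rewrite -/B sqr_sqrtr; last exact: ltW.
  rewrite oppr0 mul0r expR0 lee_fin.
  by rewrite le_eqVlt; apply/orP; left; apply/eqP; field; rewrite gt_eqF.
have sgt0 : 0 < sigma by rewrite lt_def s0.
apply: le_trans (@integral_excess_tau_le s q (2 * sigma) _ qo _) _; first by lra.
rewrite lee_fin exprMn.
have -> : - (sigma ^+ 2 * a * s%:R) / (10 * (2 ^+ 2 * sigma ^+ 2)) = - (a / 40) * s%:R.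
  by field.
by rewrite expRM_natr [in leRHS]exprMn; lra.
Qed.

End SubGaussianNoise.

(** * The oracle inequality *)

(** No integrability of [f] or [g] is assumed, so positive and negative parts are compared
    separately and the extended values are treated case by case. *)
Lemma integral_EFin_le_add (R : realType) d (T : measurableType d)
    (P : probability T R) (f g z : T -> R) (c : R) :
    measurable_fun setT f -> measurable_fun setT g -> measurable_fun setT z ->
    (forall w, 0 <= z w) -> (forall w, f w <= g w + z w) ->
    (\int[P]_w (z w)%:E <= c%:E)%E ->
  (\int[P]_w (f w)%:E <= \int[P]_w (g w)%:E + c%:E)%E.
Proof.
move=> mf mg mz z0 fgz zc.
have mF : measurable_fun setT (EFin \o f) by exact/measurable_EFinP.
have mG : measurable_fun setT (EFin \o g) by exact/measurable_EFinP.
have mZ : measurable_fun setT (EFin \o z) by exact/measurable_EFinP.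
rewrite [leLHS]integralE [X in (_ <= X + _)%E]integralE.
set a := (\int[P]_x _^\+ x)%E; set b := (\int[P]_x _^\- x)%E.
set a' := (\int[P]_x _^\+ x)%E; set b' := (\int[P]_x _^\- x)%E.
have [a0 b0 a'0 b'0] : [/\ 0 <= a, 0 <= b, 0 <= a' & 0 <= b']%E.
  by split; apply: integral_ge0 => w _; rewrite ?funepos_ge0 ?funeneg_ge0.
have maxB (x : R) : Num.max x 0 = x + Num.max (- x) 0.
  by case: (leP x 0) => x0; case: (leP (- x) 0) => x1; lra.
(* If the negative part of [g] has infinite integral, so has that of [f]; the left side is then
   [-oo], also when [a] is [+oo], by the convention for [+oo - +oo]. *)
have ineq1 : (b' <= b + c%:E)%E.
  apply: (@le_trans _ _ (b + \int[P]_w (z w)%:E)%E); last by rewrite leeD2l.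
  rewrite -ge0_integralD//; try exact: measurable_funeneg;
    try (by move=> w _; rewrite lee_fin).
  apply: ge0_le_integral => //.
  - exact: measurable_funeneg.
  - by apply: emeasurable_funD => //; exact: measurable_funeneg.
  move=> w _; rewrite !funenegE -!EFinN -!EFin_max -EFinD lee_fin.
  have h1 : - f w <= Num.max (- f w) 0 by rewrite le_max lexx.
  have h2 : 0 <= Num.max (- f w) 0 by rewrite le_max lexx orbT.
  by have := fgz w; have := z0 w; rewrite ge_max => h3 h4; apply/andP; split; lra.
have ineq2 : (a + b' <= a' + b + c%:E)%E.
  apply: (@le_trans _ _ (a' + b + \int[P]_w (z w)%:E)%E); last by rewrite leeD2l.
  rewrite -!ge0_integralD//; try exact: measurable_funeneg;
    try exact: measurable_funepos; try (by move=> w _; rewrite lee_fin);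
    try (by move=> w _; rewrite adde_ge0);
    try (by apply: emeasurable_funD; [exact: measurable_funepos|exact: measurable_funeneg]).
  apply: ge0_le_integral => //.
  - by move=> w _; rewrite adde_ge0.
  - by apply: emeasurable_funD; [exact: measurable_funepos|exact: measurable_funeneg].
  - apply: emeasurable_funD => //.
    by apply: emeasurable_funD; [exact: measurable_funepos|exact: measurable_funeneg].
  move=> w _; rewrite !funenegE !funeposE -!EFinN -!EFin_max -!EFinD lee_fin.
  by have := maxB (f w); have := maxB (g w); have := fgz w; lra.
move: a b a' b' a0 b0 a'0 b'0 ineq1 ineq2.
move=> [a||] [b||] [a'||] [b'||] //=; rewrite ?leey ?leNye//=.
by rewrite -!EFinD !lee_fin; lra.
Qed.

(** * Uniform control of the noise over all supports *)

Lemma log_ep_ge0 (R : realType) p : 0 <= log_ep p :> R.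
Proof.
case: p => [|p]; first by rewrite /log_ep mulr0 ln0.
apply: ln_ge0; have : 1 <= p.+1%:R :> R by rewrite ler1n.
have := expR_ge1Dx (1 : R); nra.
Qed.

(** The base of the net bound: [2 ^+ 10] for the squared radius and 3 for the weights, per
    dimension. *)
Definition net_constant {R : realType} : R := 2 ^+ 10 * 3.

Lemma net_constant_ge1 (R : realType) : 1 <= net_constant :> R.
Proof.
have : 1 <= 2 ^+ 10 :> R by rewrite exprn_ege1//; lra.
by rewrite /net_constant; lra.
Qed.

(** The factor 40 is that of the exponent in [integral_excess_le]. Since this number is at least 1,
    [A] above it has its square above it too. *)
Definition threshold_constant {R : realType} : R := 40 * (1 + ln net_constant).

Lemma threshold_constant_ge1 (R : realType) : 1 <= threshold_constant :> R.
Proof.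
have := ln_ge0 (net_constant_ge1 R); rewrite /threshold_constant; lra.
Qed.

(* The threshold lambda is tuned so that the excesses over all 2^p supports sum
   to an absolute constant. *)
Lemma sum_excess_bound (R : realType) (A : R) p : threshold_constant <= A ->
  (1 + net_constant * expR (- (A ^+ 2 * log_ep p / 40))) ^+ p <= expR 1.
Proof.
move=> A0A; case: p => [|p].
  by rewrite expr0; have := expR_ge1Dx (1 : R); lra.
set q := net_constant * _.
(* With [1 + q <= expR q] it is enough that [q] is at most the inverse of the dimension, which holds
   since [(1 + ln B) (1 + ln p) >= ln B + ln p], [B] being [net_constant]. *)
apply: (@le_trans _ _ (expR q ^+ p.+1)).
  rewrite lerXn2r ?nnegrE ?expR_ge0 ?expR_ge1Dx//.
  rewrite addr_ge0// mulr_ge0 ?expR_ge0//.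
  by have := net_constant_ge1 R; lra.
rewrite -expRM_natr ler_expR -[leRHS](@mulVf _ p.+1%:R) ?pnatr_eq0//.
rewrite ler_wpM2r// /q.
have p1 : 1 <= p.+1%:R :> R by rewrite ler1n.
have lnp : 0 <= ln p.+1%:R :> R by exact: ln_ge0.
have lnk : 0 <= ln net_constant :> R by exact: ln_ge0 (net_constant_ge1 R).
have kgt0 : 0 < net_constant :> R by have := net_constant_ge1 R; lra.
have AA : 40 * (1 + ln net_constant) <= A ^+ 2.
  have := threshold_constant_ge1 R; rewrite /threshold_constant in A0A * => h; nra.
have -> : log_ep p.+1 = 1 + ln p.+1%:R :> R.
  by rewrite /log_ep lnM ?posrE ?expR_gt0// expRK.
apply: (@le_trans _ _ (net_constant * expR (- ln net_constant - ln p.+1%:R))).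
  rewrite ler_pM2l// ler_expR.
  have : 40 * (1 + ln net_constant) * (1 + ln p.+1%:R) <= A ^+ 2 * (1 + ln p.+1%:R).
    by rewrite ler_wpM2r//; lra.
  have := mulr_ge0 lnk lnp; lra.
rewrite expRD !expRN !lnK ?posrE// ?mulrA ?mulfV ?mul1r ?gt_eqF//.
Qed.

Lemma sqr_lambda_level (R : realType) (A sigma delta vartheta : R) p :
    0 < delta -> 0 < vartheta ->
  lambda_level A sigma delta vartheta p ^+ 2
    = A ^+ 2 * sigma ^+ 2 * log_ep p / (Num.min delta vartheta * vartheta).
Proof.
move=> d0 v0; rewrite /lambda_level !exprMn exprVn !sqr_sqrtr ?log_ep_ge0//.
by rewrite mulr_ge0 ?le_min ?ltW.
Qed.

(** The maximum over supports is replaced by a sum of excesses. As [Z] bounds the noise for all [b]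
    at once, it may be used at a random [b] of any kind; [delta'] ensures the inequality with
    [vartheta] that thresholding requires. *)
Lemma penalized_noise_integral (R : realType) d (T : measurableType d)
    (P : probability T R) n p (X : 'M[R]_(n, p)) (xi : T -> 'cV[R]_n)
    (rho A sigma delta vartheta : R) :
    threshold_constant <= A -> 0 < delta -> 0 < vartheta ->
    spectral_norm X <= rho -> 0 < rho -> 0 <= sigma ->
    subgaussian_vec P xi sigma ->
  let delta' := Num.min delta vartheta in
  exists Z : T -> R, [/\ measurable_fun setT Z, forall w, 0 <= Z w,
    forall w b, penalized_noise X (xi w) rho
      (lambda_level A sigma delta vartheta p) delta' vartheta b <= Z w &
    (\int[P]_w (Z w)%:E <= (40 * expR 1 * sigma ^+ 2 / delta')%:E)%E].
Proof.
move=> A0A d0 v0 Xrho rho0 s0 xisub delta'.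
have d'0 : 0 < delta' by rewrite lt_min d0.
have d'v : delta' <= vartheta by rewrite ge_min lexx orbT.
have A0 : 0 <= A by apply: le_trans A0A; have := threshold_constant_ge1 R; lra.
set lambda := lambda_level _ _ _ _ _.
have lam0 : 0 <= lambda by rewrite /lambda divr_ge0 ?sqrtr_ge0// !mulr_ge0 ?sqrtr_ge0.
(* The families depend on [X] and [S] alone, not on the outcome [w]. *)
pose q (S : {set 'I_p}) := sval (cid2 (gram_schmidt (fun i : 'I_#|S| => col (enum_val i) X))).
have qo S : orthonormal_or_zero (q S) by rewrite /q; case: cid2.
have qs (S : {set 'I_p}) (a : 'I_#|S| -> R) : exists b : 'I_#|S| -> R,
    \sum_i a i *: col (enum_val i) X = \sum_i b i *: q S i.
  by rewrite /q; case: cid2.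
pose a := A ^+ 2 * log_ep p; have a0 : 0 <= a by rewrite mulr_ge0 ?sqr_ge0 ?log_ep_ge0.
pose Y S w := Num.max (\sum_i dotv (xi w) (q S i) ^+ 2 - sigma ^+ 2 * a * #|S|%:R) 0.
have mY S : measurable_fun setT (Y S).
  apply: measurable_maxr => //; apply: measurable_funB => //.
  exact: measurable_sum_dotv_sqr xisub _ _.
have Y0 S w : 0 <= Y S w by rewrite /Y le_max lexx orbT.
have mS : measurable_fun setT (fun w => \sum_(S : {set 'I_p}) Y S w).
  exact: measurable_sum.
exists (fun w => (2 * delta')^-1 * \sum_(S : {set 'I_p}) Y S w); split.
- exact: measurable_funM.
- by move=> w; rewrite mulr_ge0 ?sumr_ge0// invr_ge0 mulr_ge0// ltW.
- move=> w b.
  have [S bS] := penalized_noise_le (xi w) rho0 lam0 d'0 d'v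
    (fun j => col_dotv_le j Xrho) qo qs b.
  apply: le_trans bS _; rewrite sqr_lambda_level// -/delta'.
  apply: (@le_trans _ _ ((2 * delta')^-1 * Y S w)).
    rewrite [leLHS](_ : _ = (2 * delta')^-1 *
      (\sum_i dotv (xi w) (q S i) ^+ 2 - sigma ^+ 2 * a * #|S|%:R)).
      by rewrite ler_pM2l ?invr_gt0 ?mulr_gt0// le_max lexx.
    by rewrite /a; field; rewrite !gt_eqF.
  rewrite ler_pM2l ?invr_gt0 ?mulr_gt0// (bigD1 S)//= lerDl.
  by rewrite sumr_ge0.
rewrite (eq_integral (fun w => ((2 * delta')^-1)%:E *
  \sum_(S : {set 'I_p}) (Y S w)%:E)%E) => [|w _]; last by rewrite sumEFin EFinM.
have c0 : 0 <= (2 * delta')^-1 by rewrite invr_ge0 mulr_ge0// ltW.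
rewrite ge0_integralZl//; last 2 first.
- by apply: emeasurable_sum => S; exact/measurable_EFinP.
- by move=> w _; rewrite sume_ge0// => S _; rewrite lee_fin.
rewrite ge0_integral_sum//; last 2 first.
- by move=> S; exact/measurable_EFinP.
- by move=> S w _; rewrite lee_fin.
apply: (@le_trans _ _ (((2 * delta')^-1)%:E * \sum_(S : {set 'I_p})
   (80 * sigma ^+ 2 * (net_constant * expR (- (a / 40))) ^+ #|S|)%:E)%E).
  apply: lee_wpmul2l; first by rewrite lee_fin.
  by apply: lee_sum => S _; exact: integral_excess_le.
rewrite sumEFin -EFinM lee_fin -mulr_sumr sum_expr_card card_ord.
rewrite [leRHS](_ : _ = (2 * delta')^-1 * (80 * sigma ^+ 2 * expR 1)); last first.
  by field; rewrite gt_eqF.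
rewrite ler_wpM2l// ler_wpM2l ?mulr_ge0 ?sqr_ge0//.
exact: sum_excess_bound.
Qed.

(** * Absorption of the remaining terms and conclusion *)

Lemma P_HN (R : realType) (lambda t : R) : P_H lambda (- t) = P_H lambda t.
Proof. by rewrite /P_H normrN sqrrN. Qed.

Lemma sum_pen_P_H_sub (R : realType) (lambda rho : R) p (b c : 'cV[R]_p) :
  sum_pen (P_H lambda) (rho *: (b - c)) = sum_pen (P_H lambda) (rho *: (c - b)).
Proof.
apply: eq_bigr => i _; rewrite -P_HN; congr (P_H _ _).
by rewrite !mxE; ring.
Qed.

(** Passes from extended reals to real numbers [k] and [a]. For [r > 0], an infinite [L] has inverse
    0 and [L = 0] forces [alpha = 0], so the ratio vanishes in both cases; otherwise [a] is [alpha]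
    and the upper curvature bound controls [k * B]. *)
Lemma curvature_ratio_bounds (R : realType) (I V : Type) (alpha L : \bar R) (r : R)
    (dist : V -> V -> R) (B : I -> V -> V -> R) :
    (alpha <= L)%E -> 0 <= r -> (0 < r -> (0 <= alpha)%E) ->
    (forall w x y, (alpha * (dist x y ^+ 2)%:E <= (B w x y)%:E)%E /\
       ((B w x y)%:E <= L * (dist x y ^+ 2)%:E)%E) ->
  exists k a : R, [/\ (alpha / L * r%:E = k%:E)%E, (r = 0 -> k = 0), 0 <= a,
    (0 < r -> forall w x y, k * B w x y <= r * (a * dist x y ^+ 2)) &
    (0 < r -> forall w x y, a * dist x y ^+ 2 <= B w x y)].
Proof.
move=> aL; rewrite le_eqVlt => /predU1P[<- _ _|r0 /(_ r0) a0 HB].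
  by exists 0, 0; split => //; rewrite ?mule0// ltxx.
have B0 w x y : 0 <= B w x y.
  rewrite -lee_fin; apply: le_trans (HB w x y).1.
  by rewrite mule_ge0// lee_fin sqr_ge0.
have trivial_ratio : (alpha / L = 0)%E -> exists k a : R,
    [/\ (alpha / L * r%:E = k%:E)%E, (r = 0 -> k = 0), 0 <= a,
    (0 < r -> forall w x y, k * B w x y <= r * (a * dist x y ^+ 2)) &
    (0 < r -> forall w x y, a * dist x y ^+ 2 <= B w x y)].
  move=> ->; exists 0, 0; rewrite mul0e; split=> // _ w x y; last by rewrite mul0r.
  by rewrite !mul0r mulr0.
case: L aL HB trivial_ratio => [l| |] aL HB trivial_ratio; last 2 first.
- by apply: trivial_ratio; rewrite /inve mule0.
- by move: (le_trans a0 aL).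
case: alpha a0 aL HB trivial_ratio => [a||] // a0 al HB trivial_ratio.
rewrite !lee_fin in a0 al.
have [l0|l0] := eqVneq l 0.
  apply: trivial_ratio; have -> : a = 0 by apply/le_anti; rewrite a0 -l0 al.
  by rewrite mul0e.
have lgt0 : 0 < l by rewrite lt_def l0 (le_trans a0).
exists (a / l * r), a; split => //.
- by rewrite /inve (negbTE l0) -!EFinM.
- by move=> ->; rewrite mulr0.
- move=> _ w x y; have [_] := HB w x y; rewrite -EFinM lee_fin => Bl.
  have := ler_wpM2l (mulr_ge0 (divr_ge0 a0 (ltW lgt0)) (ltW r0)) Bl.
  move=> /le_trans; apply; rewrite le_eqVlt; apply/orP; left; apply/eqP.
  by field.
- by move=> _ w x y; have [+ _] := HB w x y; rewrite -EFinM lee_fin.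
Qed.

(* Young's inequality (d2 + d3)^2 <= (1 + c^-1) d2^2 + (1 + c) d3^2 with
   c = (1 + r) / (1 - r), which makes the coefficient of D1 equal to 1 / c. *)
Lemma absorb_curvature (R : realType) (r k a d1 d2 d3 D1 D2 D3 N : R) :
    0 <= r < 1 -> (r = 0 -> k = 0) -> 0 <= a ->
    (0 < r -> k * D3 <= r * (a * d1 ^+ 2)) ->
    (0 < r -> a * d2 ^+ 2 <= D1) -> (0 < r -> a * d3 ^+ 2 <= D2) ->
    0 <= d1 -> d1 <= d2 + d3 -> D1 <= D2 + k * D3 + N ->
  D1 <= ((1 + r) / (1 - r)) ^+ 2 * D2 + (1 + r) / (1 - r) * N.
Proof.
move=> /andP[r0 r1] rk a0 kD aD1 aD2 d10 tri DN.
move: r0; rewrite le_eqVlt => /predU1P[rE|rpos].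
  by move: DN; rewrite rk// -rE !addr0 subr0 divr1 expr1n; lra.
move: (kD rpos) (aD1 rpos) (aD2 rpos) => {}kD {}aD1 {}aD2.
set c := (1 + r) / (1 - r).
have c0 : 0 < c by rewrite divr_gt0//; lra.
have young : d1 ^+ 2 <= (1 + c^-1) * d2 ^+ 2 + (1 + c) * d3 ^+ 2.
  apply: (@le_trans _ _ ((d2 + d3) ^+ 2)).
    by rewrite lerXn2r// nnegrE// (le_trans d10).
  rewrite -subr_ge0.
  have -> : (1 + c^-1) * d2 ^+ 2 + (1 + c) * d3 ^+ 2 - (d2 + d3) ^+ 2
     = (d2 - c * d3) ^+ 2 / c by field; rewrite gt_eqF.
  by rewrite divr_ge0 ?sqr_ge0// ltW.
have c1 : 0 <= 1 + c^-1 by rewrite addr_ge0// invr_ge0 ltW.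
have kD' : k * D3 <= r * ((1 + c^-1) * D1 + (1 + c) * D2).
  apply: le_trans kD _; rewrite ler_pM2l//.
  apply: le_trans (ler_wpM2l a0 young) _.
  have := ler_wpM2l c1 aD1; have : (1 + c) * (a * d3 ^+ 2) <= (1 + c) * D2.
    by rewrite ler_wpM2l//; lra.
  lra.
have p1 : 1 + r != 0 by rewrite gt_eqF//; lra.
have p2 : 1 - r != 0 by rewrite gt_eqF//; lra.
have e1 : 1 - r * (1 + c^-1) = c^-1 by rewrite /c; field; rewrite ?p1 ?p2.
have e2 : 1 + r * (1 + c) = c by rewrite /c; field; rewrite ?p1 ?p2.
have : c^-1 * D1 <= c * D2 + N.
  have -> : c^-1 * D1 = D1 - r * (1 + c^-1) * D1 by rewrite -{1}e1; ring.
  have -> : c * D2 = D2 + r * (1 + c) * D2 by rewrite -{1}e2; ring.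
  lra.
rewrite mulrC ler_pdivrMr// => /le_trans; apply.
by rewrite le_eqVlt; apply/orP; left; apply/eqP; ring.
Qed.

(** The level [lambda] involves [delta'], the final bound involves [m]. Both equal [delta] when
    [delta <= vartheta]; otherwise [delta'] is [vartheta], and [J <= q] lets the surplus enter
    [C]. *)
Lemma absorb_threshold_mismatch (R : realType) (K a J q c delta vartheta : R) :
    0 <= K -> 0 <= a -> 0 <= J -> J <= q -> 0 < delta -> 0 < vartheta -> 0 < c ->
  let m := Num.min (2 * vartheta) delta in
  let delta' := Num.min delta vartheta in
  let C := if delta <= vartheta then c
           else c * m / vartheta + K * a * q * m / vartheta ^+ 2 in
  [/\ 0 < C, 0 <= K * a / (delta' * vartheta) * J - K * a / (m * vartheta) * J &
    K * a / (delta' * vartheta) * J - K * a / (m * vartheta) * J + c / delta'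
      <= C / m].
Proof.
move=> K0 a0 J0 Jq d0 v0 c0 m delta' C.
have m0 : 0 < m by rewrite lt_min d0 mulr_gt0.
have Ka : 0 <= K * a by rewrite mulr_ge0.
have KaJ : 0 <= K * a * J by rewrite mulr_ge0.
rewrite /C /delta'; case: (leP delta vartheta) => dv.
  have -> : m = delta by rewrite /m min_r//; lra.
  by rewrite subrr add0r; split.
have mv : vartheta <= m by rewrite /m le_min (ltW dv) andbT; lra.
split.
- by rewrite ltr_pwDl ?divr_gt0 ?mulr_gt0// divr_ge0 ?sqr_ge0// !mulr_ge0 ?(ltW m0)// (le_trans J0).
- rewrite -mulrBl mulr_ge0// -mulrBr mulr_ge0// subr_ge0 lef_pV2 ?posrE ?mulr_gt0//.
  by rewrite ler_pM2r.
rewrite [leRHS](_ : _ = K * a * q / vartheta ^+ 2 + c / vartheta); last first.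
  by field; rewrite !gt_eqF.
rewrite lerD2r lerBlDr ler_wpDr//.
  by rewrite !mulr_ge0// invr_ge0 mulr_ge0// ltW.
by rewrite -expr2 -mulrA -[leRHS]mulrA ler_wpM2l// mulrC ler_pM2r ?invr_gt0 ?exprn_gt0.
Qed.

Lemma integral_affine_le (R : realType) d (T : measurableType d)
    (P : probability T R) (Z : T -> R) (k x c : R) :
    measurable_fun setT Z -> (forall w, 0 <= Z w) -> 0 <= k -> 0 <= x ->
    (\int[P]_w (Z w)%:E <= c%:E)%E ->
  (\int[P]_w (k * (Z w + x))%:E <= (k * (c + x))%:E)%E.
Proof.
move=> mZ Z0 k0 x0 Zc.
have mZE : measurable_fun setT (fun w => (Z w)%:E) by exact/measurable_EFinP.
rewrite (eq_integral (fun w => k%:E * ((Z w)%:E + cst x%:E w))%E) => [|w _]; last first.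
  by rewrite EFinM EFinD.
rewrite ge0_integralZl//; last 2 first.
- by apply: emeasurable_funD.
- by move=> w _; rewrite adde_ge0 ?lee_fin.
rewrite ge0_integralD//; try by move=> w _; rewrite lee_fin.
rewrite integral_cst// [X in (_ * (_ + _ * X))%E]probability_setT mule1.
by rewrite EFinM EFinD; apply: lee_wpmul2l; [rewrite lee_fin|rewrite leeD2r].
Qed.

(** The deterministic core, for one outcome: adding the first-order inequality to the condition at
    [betahat] cancels both penalties and one copy of the Bregman term; linearization at
    [X *m betastar] then produces the noise. *)
Lemma oracle_inequality_pointwise (R : realType) n p (X : 'M[R]_(n, p))
    (rho lambda delta vartheta r k a N Z : R) (l0 : 'cV[R]_n -> R)
    (psi : 'cV[R]_p -> R) (Theta : R -> R -> R) (dist : 'cV[R]_n -> 'cV[R]_n -> R)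
    (betastar beta betahat : 'cV[R]_p) :
  let l := fun b => l0 (X *m b) in
  let delta' := Num.min delta vartheta in
  dir_differentiable l -> dir_differentiable psi -> thresholding Theta ->
  0 <= lambda -> differentiable l0 (X *m betastar) -> pseudo_metric dist ->
  0 <= r < 1 -> (r = 0 -> k = 0) -> 0 <= a ->
  (0 < r -> forall x y, k * Bregman l0 x y <= r * (a * dist x y ^+ 2)) ->
  (0 < r -> forall x y, a * dist x y ^+ 2 <= Bregman l0 x y) ->
  rho ^+ 2 * L_Theta Theta lambda * D2 beta betahat
    + delta * D2 (X *m beta) (X *m betahat)
    + vartheta * sum_pen (P_H lambda) (rho *: (beta - betahat))
    + sum_pen (P_Theta Theta lambda) (rho *: beta)
  <= (1 + k) * Bregman l beta betahat
     + (sum_pen (P_Theta Theta lambda) (rho *: betahat) + N) ->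
  fixed_point l psi Theta rho lambda betahat ->
  penalized_noise X (- grad l0 (X *m betastar)) rho lambda delta' vartheta
    (betahat - beta) <= Z ->
  Bregman l betahat betastar
    <= ((1 + r) / (1 - r)) ^+ 2 * Bregman l beta betastar
       + (1 + r) / (1 - r) * (N + Z).
Proof.
move=> l delta' dl dpsi thr lam0 dl0 [dist0 distC distT] r01 rk a0 kB aB cond fp noise.
have [r0 r1] := andP r01.
have first_order := fixed_point_first_order beta dl dpsi thr lam0 fp.
have star b : Bregman l b betastar = l b - l betastar
    - dotv (grad l0 (X *m betastar)) (X *m b - X *m betastar).
  by rewrite Bregman_comp /Bregman (ddir_grad _ dl0).
apply: (@absorb_curvature _ r k a (dist (X *m beta) (X *m betahat))
  (dist (X *m betahat) (X *m betastar)) (dist (X *m beta) (X *m betastar))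
  _ _ (Bregman l beta betahat) (N + Z)) => //.
- by move=> /kB; rewrite Bregman_comp; apply.
- by move=> /aB; rewrite Bregman_comp; apply.
- by move=> /aB; rewrite Bregman_comp; apply.
- by rewrite addrC.
have D2s : D2 (X *m beta) (X *m betahat)
    = dotv (X *m (betahat - beta)) (X *m (betahat - beta)) / 2.
  rewrite D2E -mulmxBr -(opprB betahat) mulmxN dotvNl dotvNr opprK//.
have D2ge0 : delta' * D2 (X *m beta) (X *m betahat) <= delta * D2 (X *m beta) (X *m betahat).
  by rewrite ler_wpM2r ?ge_min ?lexx// D2s divr_ge0 ?dotv_ge0.
have noiseE : dotv (- grad l0 (X *m betastar)) (X *m (betahat - beta)) =
    dotv (grad l0 (X *m betastar)) (X *m beta)
    - dotv (grad l0 (X *m betastar)) (X *m betahat).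
  by rewrite dotvNl mulmxBr dotvBr opprB.
move: noise cond; rewrite /penalized_noise sum_pen_P_H_sub noiseE !star !dotvBr.
move: D2ge0; rewrite D2s. lra.
Qed.

(* C0 is an absolute constant.  The constant C of the oracle inequality equals
   C0 when delta <= vartheta, and may otherwise depend on A, p, K, delta and
   vartheta; it never depends on the remaining data. *)
Theorem theorem4 (R : realType) :
  exists A0 C0 : R, [/\ 0 < A0, 0 < C0 &
  forall (A : R) (p : nat) (K delta vartheta : R),
  A0 <= A -> 0 <= K -> 0 < delta -> 0 < vartheta ->
  exists C : R, [/\ 0 < C, (delta <= vartheta -> C = C0) &
  forall (disp : measure_display) (T : measurableType disp) (P : probability T R)
    (n : nat) (X : 'M[R]_(n, p)) (rho sigma r : R)
    (l0 : T -> 'cV[R]_n -> R) (psi : T -> 'cV[R]_p -> R) (Theta : R -> R -> R)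
    (dist : 'cV[R]_n -> 'cV[R]_n -> R) (alpha L : \bar R)
    (betastar beta : 'cV[R]_p) (betahat : T -> 'cV[R]_p),
  let l := fun w b => l0 w (X *m b) in
  let eps := fun w => - grad (l0 w) (X *m betastar) in
  let lambda := lambda_level A sigma delta vartheta p in
  spectral_norm X <= rho -> 0 < rho -> 0 <= sigma ->
  (forall w, dir_differentiable (l w)) ->
  (forall w, dir_differentiable (psi w)) ->
  thresholding Theta ->
  (forall w, differentiable (l0 w) (X *m betastar)) ->
  subgaussian_vec P eps sigma ->
  mean_zero_vec P eps ->
  pseudo_metric dist ->
  (alpha <= L)%E ->
  (forall w eta eta',
     (alpha * (dist eta eta' ^+ 2)%:E <= (Bregman (l0 w) eta eta')%:E)%E /\
     ((Bregman (l0 w) eta eta')%:E <= L * (dist eta eta' ^+ 2)%:E)%E) ->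
  0 <= r < 1 ->
  (0 <= alpha / L * r%:E)%E ->
  (0 < r -> (0 <= alpha)%E) ->
  (forall w gamma,
     ((rho ^+ 2 * L_Theta Theta lambda * D2 beta gamma
       + delta * D2 (X *m beta) (X *m gamma)
       + vartheta * sum_pen (P_H lambda) (rho *: (beta - gamma))
       + sum_pen (P_Theta Theta lambda) (rho *: beta))%:E
      <= (1 + alpha / L * r%:E) * (Bregman (l w) beta gamma)%:E
       + (sum_pen (P_Theta Theta lambda) (rho *: gamma)
          + K * lambda ^+ 2 * (l0norm beta)%:R)%:E)%E) ->
  (forall w, fixed_point (l w) (psi w) Theta rho lambda (betahat w)) ->
  measurable_fun setT (fun w => Bregman (l w) (betahat w) betastar) ->
  measurable_fun setT (fun w => Bregman (l w) beta betastar) ->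
  ('E_P[fun w => Bregman (l w) (betahat w) betastar]
   <= 'E_P[fun w =>
        (((1 + r) / (1 - r)) ^+ 2 * Bregman (l w) beta betastar
         + (1 + r) * K * A ^+ 2
           / ((1 - r) * Num.min (2 * vartheta) delta * vartheta)
           * sigma ^+ 2 * (l0norm beta)%:R * log_ep p)%R]
      + (C * (1 + r) / ((1 - r) * Num.min (2 * vartheta) delta)
         * sigma ^+ 2)%:E)%E]].
Proof.
exists threshold_constant, (40 * expR 1).
have c0 : 0 < 40 * expR 1 :> R by rewrite mulr_gt0 ?expR_gt0.
split=> //; first by have := threshold_constant_ge1 R; lra.
move=> A p K delta vartheta A0A K0 d0 v0.
have Ap0 : 0 <= A ^+ 2 * log_ep p by rewrite mulr_ge0 ?sqr_ge0 ?log_ep_ge0.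
set m := Num.min (2 * vartheta) delta; set delta' := Num.min delta vartheta.
have m0 : 0 < m by rewrite lt_min d0 mulr_gt0.
exists (if delta <= vartheta then 40 * expR 1 else
  40 * expR 1 * m / vartheta + K * (A ^+ 2 * log_ep p) * p%:R * m / vartheta ^+ 2).
split.
- by have [] := absorb_threshold_mismatch K0 Ap0 (ler0n R 0) (ler0n R p) d0 v0 c0.
- by move=> ->.
move=> disp T P n X rho sigma r l0 psi Theta dist alpha L betastar beta betahat.
move=> l eps lambda Xrho rho0 s0 dl dpsi thr dl0 sub _ pm aL HB r01 _ ra cond fp mf mg.
have [r0 r1] := andP r01.
have J_le : (l0norm beta)%:R <= p%:R :> R.
  by rewrite ler_nat; apply: leq_trans (max_card _) _; rewrite card_ord.
have [_] := absorb_threshold_mismatch K0 Ap0 (ler0n R (l0norm beta)) J_le d0 v0 c0.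
rewrite -/m -/delta'; set C := (if _ then _ else _).
set ex := (X in 0 <= X) => ex0 exC.
have lam0 : 0 <= lambda.
  rewrite /lambda /lambda_level divr_ge0 ?sqrtr_ge0// !mulr_ge0 ?sqrtr_ge0//.
  by apply: le_trans A0A; have := threshold_constant_ge1 R; lra.
have [k [a [kE rk a0 kB aB]]] := curvature_ratio_bounds aL r0 ra HB.
have [Z [mZ Z0 noise EZ]] :=
  penalized_noise_integral (p := p) A0A d0 v0 Xrho rho0 s0 sub.
have r'0 : 0 <= (1 + r) / (1 - r) by rewrite divr_ge0//; lra.
have lamE : K * lambda ^+ 2 * (l0norm beta)%:R
    = sigma ^+ 2 * (K * (A ^+ 2 * log_ep p) / (delta' * vartheta) * (l0norm beta)%:R).
  by rewrite sqr_lambda_level// -/delta'; ring.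
pose c2 := (1 + r) * K * A ^+ 2 / ((1 - r) * m * vartheta) * sigma ^+ 2
  * (l0norm beta)%:R * log_ep p.
have c2E : c2 = (1 + r) / (1 - r) * (sigma ^+ 2 *
   (K * (A ^+ 2 * log_ep p) / (m * vartheta) * (l0norm beta)%:R)).
  rewrite /c2; field; rewrite !gt_eqF//; lra.
(* The nonnegative remainder gathers the noise bound [Z] and the surplus [ex] of the sparsity term
   over the one in the conclusion. *)
rewrite unlock; apply: (integral_EFin_le_add (z := fun w =>
   (1 + r) / (1 - r) * (Z w + sigma ^+ 2 * ex))) => //.
- by apply: measurable_funD => //; exact: measurable_funM.
- by apply: measurable_funM => //; exact: measurable_funD.
- by move=> w; apply: mulr_ge0 => //; apply: addr_ge0 => //; rewrite mulr_ge0 ?sqr_ge0.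
- move=> w.
  have := cond w (betahat w).
  rewrite kE (_ : (1 + k%:E)%E = (1 + k)%:E)// -EFinM -EFinD lee_fin => cond'.
  have := oracle_inequality_pointwise (dl w) (dpsi w) thr lam0 (dl0 w) pm r01 rk a0
    (fun h => kB h w) (fun h => aB h w) cond' (fp w) (noise w (betahat w - beta)).
  move=> /le_trans; apply.
  rewrite -/m -/c2 c2E lamE -addrA lerD2l -mulrDr le_eqVlt; apply/orP; left; apply/eqP.
  by rewrite /ex; ring.
apply: le_trans (integral_affine_le mZ Z0 r'0 _ EZ) _.
  by rewrite mulr_ge0 ?sqr_ge0.
rewrite lee_fin.
have -> : C * (1 + r) / ((1 - r) * m) * sigma ^+ 2 = (1 + r) / (1 - r) * (sigma ^+ 2 * (C / m)).
  by field; rewrite !gt_eqF//; lra.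
rewrite ler_wpM2l//.
have -> : 40 * expR 1 * sigma ^+ 2 / delta' + sigma ^+ 2 * ex
  = sigma ^+ 2 * (ex + 40 * expR 1 / delta') by ring.
by rewrite ler_wpM2l ?sqr_ge0.
Qed.
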